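(* Let $V$ denote the value function of the zero-sum game. Then a pure global Markovian equilibrium exists if and only if $$h(x)\vee\alpha\Pi V(x)\ge (f\wedge g)(x)\quad\text{and}\quad h(x)\wedge\alpha\Pi V(x)\le (f\vee g)(x),\quad\text{for all }x\in E.$$
   Context: Setting. $X=(X_n)_{n\in\mathbb{N}_0}$ is a homogeneous Markov process with (measurable) state space $E$ and Markov kernel $\Pi$; under $\mathbb{P}_x$ (expectation $\mathbb{E}_x$) it starts at $X_0=x\in E$. Write $\Pi u(x)=\int_E u(y)\,\Pi(x,dy)$. The discount factor $\alpha\in(0,1)$ is constant and $f,g,h:E\to\mathbb{R}$ are measurable. The probability space supports two sequences $(\xi^{(i)}_n)_{n\in\mathbb{N}_0}$, $i=1,2$, of iid uniform $(0,1)$ random variables, independent of $X$ and of each other. Killed process. $\tilde X$ is the process $X$ killed at each time step with probability $1-\alpha$ (independently of everything else): $\tilde X_n=X_n$ for $n\le T$ and $\tilde X_n=K$ for $n>T$, where $\mathbb{P}(T=k)=(1-\alpha)\alpha^k$, $k\in\mathbb{N}_0$, and $K$ is an absorbing cemetery state at which all functions take the value $0$. Standing integrability assumption. Under every $\mathbb{P}_x$: $\sup_{n}|f(\tilde X_n)|,\ \sup_{n}|g(\tilde X_n)|,\ \sup_{n}|h(\tilde X_n)|\in L^1$. Stopping times. $\mathcal{T}_i$ is the set of ($\mathbb{N}_0\cup\{\infty\}$-valued) stopping times with respect to the filtration $\sigma(X_0,\dots,X_n,\xi^{(i)}_0,\dots,\xi^{(i)}_n)$, $n\in\mathbb{N}_0$.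 For measurable $p^{(i)}:E\to[0,1]$, let $\tau^{p^{(i)}}=\inf\{n\in\mathbb{N}_0:\ p^{(i)}(X_n)\ge\xi^{(i)}_n\}$ ($\inf\emptyset=\infty$), the Markovian randomized stopping time of player $i$ identified with $p^{(i)}$. Zero-sum game. Player 1 chooses $\tau_1\in\mathcal{T}_1$ to maximize, and player 2 chooses $\tau_2\in\mathcal{T}_2$ to minimize, $$J_1(x;\tau_1,\tau_2)=\mathbb{E}_x\big[\alpha^{\tau_1}f(X_{\tau_1})\mathbb{I}_{\{\tau_1<\tau_2\}}+\alpha^{\tau_2}g(X_{\tau_2})\mathbb{I}_{\{\tau_2<\tau_1\}}+\alpha^{\tau_1}h(X_{\tau_1})\mathbb{I}_{\{\tau_1=\tau_2<\infty\}}\big].$$ $(p^{(1)},p^{(2)})$ is a global Markovian (randomized) equilibrium if for all $x\in E$: $\sup_{\tau_1\in\mathcal{T}_1}J_1(x;\tau_1,\tau^{p^{(2)}})=J_1(x;\tau^{p^{(1)}},\tau^{p^{(2)}})=\inf_{\tau_2\in\mathcal{T}_2}J_1(x;\tau^{p^{(1)}},\tau_2)$; it is pure if $p^{(1)}(x),p^{(2)}(x)\in\{0,1\}$ for all $x\in E$. Value. The value of a global Markovian equilibrium is $V(x)=J_1(x;\tau^{p^{(1)}},\tau^{p^{(2)}})$. Under the standing assumptions a global Markovian (randomized) equilibrium exists, and all such equilibria have the same value, which equals $\sup_{\tau_1\in\mathcal{T}_1}\inf_{\tau_2\in\mathcal{T}_2}J_1(x;\tau_1,\tau_2)=\inf_{\tau_2\in\mathcal{T}_2}\sup_{\tau_1\in\mathcal{T}_1}J_1(x;\tau_1,\tau_2)$;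 this function $V:E\to\mathbb{R}$ is the value function of the game. *)

(* Defs.v *)
From HB Require Import structures.
From mathcomp Require Import all_boot all_order all_algebra finmap.
From mathcomp Require Import all_classical all_reals all_analysis.

Set Implicit Arguments.
Unset Strict Implicit.
Unset Printing Implicit Defensive.

Import Order.TTheory GRing.Theory Num.Theory.
Import numFieldNormedType.Exports.

Local Open Scope classical_set_scope.
Local Open Scope ring_scope.

Section sigma_algebras.
Context d (Omega : measurableType d).

Definition sigma_process d' (S : measurableType d')
    (Y : nat -> {mfun Omega >-> S}) : set_system Omega :=
  <<s \bigcup_k preimage_set_system setT (Y k) measurable >>.

Definition natural_filtration d' (S : measurableType d')
    (Y : nat -> {mfun Omega >-> S}) (n : nat) : set_system Omega :=
  <<s \bigcup_(k in `I_n.+1) preimage_set_system setT (Y k) measurable >>.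

Definition joint_filtration d1 d2 (S1 : measurableType d1)
    (S2 : measurableType d2) (Y1 : nat -> {mfun Omega >-> S1})
    (Y2 : nat -> {mfun Omega >-> S2}) (n : nat) : set_system Omega :=
  <<s \bigcup_(k in `I_n.+1) (preimage_set_system setT (Y1 k) measurable `|`
                              preimage_set_system setT (Y2 k) measurable) >>.

(* [None] is the time infinity. *)
Definition is_stopping_time (F : nat -> set_system Omega)
    (tau : Omega -> option nat) : Prop :=
  forall n, F n [set w | exists2 k, (k <= n)%N & tau w = Some k].

Definition mutually_independent (R : realType) (P : probability Omega R)
    (I : choiceType) (G : I -> set_system Omega) : Prop :=
  forall (J : {fset I}) (A : I -> set Omega),
    (forall i, i \in J -> G i (A i)) ->
    P (\bigcap_(i in [set` J]) A i) = (\prod_(i <- J) P (A i))%E.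

End sigma_algebras.

Section setting.
Context d (Omega : measurableType d) (R : realType) (P : probability Omega R).

(* P(X_(n+1) \in B | X_0, ..., X_n) = Pi(X_n, B), in integrated form. The
   initial condition is on the law of X_0 because {x} need not be measurable. *)
Definition is_markov_process d' (E : measurableType d') (Pi : R.-pker E ~> E)
    (X : nat -> {mfun Omega >-> E}) (x : E) : Prop :=
  (forall B, measurable B -> P (X 0%N @^-1` B) = \d_x B) /\
  (forall n A B, natural_filtration X n A -> measurable B ->
     P (A `&` X n.+1 @^-1` B) = (\int[P]_(w in A) Pi (X n w) B)%E).

Definition is_iid_uniform (xi : nat -> {mfun Omega >-> R}) : Prop :=
  (forall n B, measurable B -> P (xi n @^-1` B) = uniform_prob (@ltr01 R) B) /\
  mutually_independent P
    (fun n => preimage_set_system setT (xi n) measurable).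

Definition is_killing_time (alpha : R) (T : {mfun Omega >-> nat}) : Prop :=
  forall k, P (T @^-1` [set k]) = ((1 - alpha) * alpha ^+ k)%:E.

Definition independent_sources d' (E : measurableType d')
    (X : nat -> {mfun Omega >-> E}) (xi1 xi2 : nat -> {mfun Omega >-> R})
    (T : {mfun Omega >-> nat}) : Prop :=
  mutually_independent P
    (tnth [tuple sigma_process X; sigma_process xi1; sigma_process xi2;
                 preimage_set_system setT T measurable]).

(* [None] is the cemetery state. *)
Definition killed d' (E : measurableType d') (X : nat -> {mfun Omega >-> E})
    (T : {mfun Omega >-> nat}) (n : nat) (w : Omega) : option E :=
  if (n <= T w)%N then Some (X n w) else None.

Definition sup_killed_in_L1 d' (E : measurableType d')
    (X : nat -> {mfun Omega >-> E}) (T : {mfun Omega >-> nat})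
    (u : E -> R) : Prop :=
  P.-integrable setT
    (fun w => ereal_sup (range (fun n => `|oapp u 0 (killed X T n w)|%:E))).

End setting.

Section game.
Context d (Omega : measurableType d) (R : realType).
Context d' (E : measurableType d').

Definition kernel_op (Pi : R.-pker E ~> E) (u : E -> R) (x : E) : R :=
  \int[Pi x]_y u y.

Definition markov_time (X : nat -> {mfun Omega >-> E})
    (xi : nat -> {mfun Omega >-> R}) (p : E -> R) (w : Omega) : option nat :=
  match pselect (exists n, xi n w <= p (X n w)) with
  | left ex => Some (ex_minn ex)
  | right _ => None
  end.

Variables (P : E -> probability Omega R) (X : nat -> {mfun Omega >-> E}).
Variables (xi1 xi2 : nat -> {mfun Omega >-> R}) (alpha : R) (f g h : E -> R).

Definition payoff (tau1 tau2 : Omega -> option nat) (w : Omega) : R :=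
  match tau1 w, tau2 w with
  | Some m, Some n =>
      if (m < n)%N then alpha ^+ m * f (X m w)
      else if (n < m)%N then alpha ^+ n * g (X n w)
      else alpha ^+ m * h (X m w)
  | Some m, None => alpha ^+ m * f (X m w)
  | None, Some n => alpha ^+ n * g (X n w)
  | None, None => 0
  end.

Definition J1 (x : E) (tau1 tau2 : Omega -> option nat) : \bar R :=
  ('E_(P x)[payoff tau1 tau2])%E.

Definition strategies (xi : nat -> {mfun Omega >-> R}) :
    set (Omega -> option nat) :=
  is_stopping_time (joint_filtration X xi).

(* Under the standing assumptions sup inf = inf sup is finite and is the common
   value of all equilibria. *)
Definition value (x : E) : R :=
  fine (ereal_sup [set ereal_inf [set J1 x tau1 tau2 | tau2 in strategies xi2]
                  | tau1 in strategies xi1]).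

Definition markov_strategy (p : E -> R) : Prop :=
  measurable_fun setT p /\ forall x, 0 <= p x <= 1.

Definition markov_equilibrium (p1 p2 : E -> R) : Prop :=
  [/\ markov_strategy p1, markov_strategy p2 &
   forall x,
     let tau1 := markov_time X xi1 p1 in let tau2 := markov_time X xi2 p2 in
     ereal_sup [set J1 x s1 tau2 | s1 in strategies xi1] = J1 x tau1 tau2 /\
     J1 x tau1 tau2 = ereal_inf [set J1 x tau1 s2 | s2 in strategies xi2]].

Definition pure (p : E -> R) : Prop := forall x, p x = 0 \/ p x = 1.

End game.

(* Main.v *)
From HB Require Import structures.
Require Import Defs.
From mathcomp Require Import all_boot all_order all_algebra finmap ring lra.
From mathcomp Require Import all_classical all_reals all_analysis measurable_realfun.

Set Implicit Arguments.
Unset Strict Implicit.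
Unset Printing Implicit Defensive.

Import Order.TTheory GRing.Theory Num.Theory.
Import numFieldNormedType.Exports.
Local Open Scope classical_set_scope.
Local Open Scope ring_scope.

(** Consider the two-by-two matrix game in which each player stops or continues,
    with payoffs [h] if both stop, [f] if only player 1 does, [g] if only player 2
    does, and [alpha * Pi u] if nobody does. Such a game lacks a saddle point in
    pure strategies exactly when both entries of one diagonal strictly exceed both
    entries of the other. With [u = V] the two inequalities of the theorem exclude
    precisely these two configurations, so the theorem says that a pure equilibrium
    exists if and only if the matrix game at every state has a pure saddle point.

    The link between the stopping game and the matrix games is that [V] solves the
    Shapley equation: [V x] is the value of the matrix game at [x]. Since [f], [g]
    and [h] are unbounded, everything rests on a majorant [M], the smallest
    alpha-excessive function above [`|f| + `|g| + `|h|]. Reading the discount factor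
    as a killing probability, the integrable suprema along the killed process
    bound [M] and force [alpha ^+ n * E_x (M (X n))] to vanish ([majorant_exists]).
    The Shapley operator is monotone and preserves the functions between [- M] and
    [M]; its iterates from [- M] increase to a fixed point [u] ([shapley_fixpoint]).

    If a player uses at each stage a probability of stopping that is optimal in
    the matrix game, then, whatever stopping time the opponent uses, the payoff
    already collected plus the discounted value of [u] on the event that the game
    is still running is a super- or submartingale, and [M] controls the remainder
    ([verification]). Hence both players can secure [u], so [V = u]
    ([value_shapley]) and stagewise optimal strategies form an equilibrium
    ([optimal_equilibrium]). If all matrix games have pure saddle points, these
    strategies can be taken pure; this is the sufficiency.

    For the necessity, each player's equilibrium time secures [u x] from [x]. If
    player 1 stops at [x], the replies of stopping at once and of never stopping
    show that [u x] is at most [h x] and [f x]; if player 1 continues at [x], the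
    replies of stopping at once and of continuing once before playing stagewise
    optimally show that it is at most [g x] and the continuation payoff
    ([secured_stop], [secured_continue]). With the same facts for player 2, each of
    the four pure pairs is a saddle point, whence the inequalities ([pure_saddle]).

    Only one player is treated directly: exchanging the players and changing signs
    turns the payoffs [(f, g, h)] into [(- g, - f, - h)] ([payoff_mirror]). *)

(** * Functionals determined by indicators *)

Import HBNNSimple.

Section ge0_functional.
Context d (S : measurableType d) (R : realType).
Implicit Types (Phi Psi : (S -> \bar R) -> \bar R) (u v : S -> \bar R).

Definition ge0_measurable u := measurable_fun setT u /\ forall x, (0 <= u x)%E.

(** What integration against any measure, kernel or density has in common; two
    such functionals are compared on indicators instead of redoing the
    approximation by simple functions for each identity below. *)
Record monotone_functional Phi : Prop := MonotoneFunctional {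
  mfuncD : forall u v, ge0_measurable u -> ge0_measurable v ->
    Phi (u \+ v)%E = (Phi u + Phi v)%E ;
  mfuncZ : forall (r : R) u, 0 <= r -> ge0_measurable u ->
    Phi (fun x => r%:E * u x)%E = (r%:E * Phi u)%E ;
  mfunc_lim : forall u_ : nat -> S -> \bar R, (forall n, ge0_measurable (u_ n)) ->
    (forall x, {homo u_ ^~ x : n m / (n <= m)%N >-> (n <= m)%E}) ->
    Phi (fun x => limn (u_ ^~ x)) = limn (Phi \o u_) }.

(** Linearity carries the equality from indicators to simple functions, and
    monotone limits carry it to all nonnegative measurable functions. *)
Lemma monotone_functional_ext Phi Psi :
  monotone_functional Phi -> monotone_functional Psi ->
  (forall B, measurable B -> Phi (EFin \o \1_B) = Psi (EFin \o \1_B)) ->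
  forall u, ge0_measurable u -> Phi u = Psi u.
Proof.
move=> HPhi HPsi ind.
have ge0_indic B : measurable B -> ge0_measurable (EFin \o \1_B : S -> \bar R).
  move=> mB; split; last by move=> x; rewrite lee_fin indicE; case: (_ \in _).
  exact/measurable_EFinP/measurable_indic.
have simple (h : {nnsfun S >-> R}) : Phi (EFin \o h) = Psi (EFin \o h).
  have -> : EFin \o h = (fun x => \sum_(r <- fset_set (range h))
      (r%:E * (EFin \o \1_(h @^-1` [set r])) x))%E.
    apply/funext => x /=; rewrite fimfunE fsbig_finite//= -sumEFin.
    by apply: eq_bigr => r _; rewrite EFinM.
  have rge0 r : r \in finmap.enum_fset (fset_set (range h)) -> 0 <= r.
    by rewrite -[_ \in _]/(r \in fset_set (range h)) in_fset_set// inE => -[x _ <-].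
  elim: (finmap.enum_fset _) rge0 => [|r s IH] rge0.
    rewrite (_ : (fun _ => _) = (fun x => 0%:E * (EFin \o \1_setT) x)%E);
      last by apply/funext => x; rewrite big_nil mul0e.
    by rewrite (mfuncZ HPhi)// ?(mfuncZ HPsi)// ?mul0e//; exact: ge0_indic.
  have r0 : 0 <= r by apply: rge0; rewrite inE eqxx.
  have s0 t : t \in s -> 0 <= t by move=> ts; apply: rge0; rewrite inE ts orbT.
  have mh t : measurable (h @^-1` [set t]) by [].
  have g0 t : 0 <= t ->
      ge0_measurable (fun x => t%:E * (EFin \o \1_(h @^-1` [set t])) x)%E.
    move=> t0; have [mi i0] := ge0_indic _ (mh t); split.
      exact: measurable_funeM.
    by move=> x; rewrite mule_ge0.
  rewrite (_ : (fun _ => _) =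
      ((fun x => r%:E * (EFin \o \1_(h @^-1` [set r])) x) \+
       (fun x => \sum_(t <- s) (t%:E * (EFin \o \1_(h @^-1` [set t])) x)))%E);
    last by apply/funext => x; rewrite big_cons.
  have gs : ge0_measurable (fun x =>
      \sum_(t <- s) (t%:E * (EFin \o \1_(h @^-1` [set t])) x))%E.
    split.
      apply: emeasurable_sum => t; exact: measurable_funeM (ge0_indic _ (mh t)).1.
    move=> x; rewrite big_seq sume_ge0// => t ts.
    by apply: mule_ge0; [rewrite lee_fin s0|exact: (ge0_indic _ (mh t)).2].
  rewrite (mfuncD HPhi) ?(mfuncD HPsi)//; [|exact: g0|exact: g0].
  rewrite IH//; congr (_ + _)%E.
  by rewrite (mfuncZ HPhi)// ?(mfuncZ HPsi)// ?ind//; exact: ge0_indic.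
move=> u [mu u0].
pose h := nnsfun_approx measurableT mu.
have -> : u = (fun x => limn (fun n => (h n x)%:E)).
  apply/funext => x; apply/esym/cvg_lim => //; exact: cvg_nnsfun_approx.
have gh n : ge0_measurable (fun x => (h n x)%:E).
  by split=> [|x]; [exact/measurable_EFinP|rewrite lee_fin].
have ndh x : {homo (fun n => (h n x)%:E) : n m / (n <= m)%N >-> (n <= m)%E}.
  by move=> n m nm; rewrite lee_fin; exact/lefP/nd_nnsfun_approx.
rewrite (mfunc_lim HPhi)// (mfunc_lim HPsi)//.
by congr (limn _); apply/funext => n; exact: simple.
Qed.

End ge0_functional.

Section functionals.
Context d (Omega : measurableType d) (R : realType).
Context d' (S : measurableType d').
Variable P : {measure set Omega -> \bar R}.

Lemma monotone_functional_comp A (Y : Omega -> S) : measurable A ->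
  measurable_fun setT Y ->
  monotone_functional (fun u : S -> \bar R => \int[P]_(w in A) u (Y w))%E.
Proof.
move=> mA mY.
have mc u : ge0_measurable u -> measurable_fun A (fun w => u (Y w)).
  move=> [mu _]; apply: measurable_funS (measurableT_comp mu mY) => //.
have nn u : ge0_measurable u -> forall w, A w -> (0 <= u (Y w))%E.
  by move=> [_ u0] w _; exact: u0.
split=> [u v gu gv|r u r0 gu|u_ gu nd].
- by rewrite ge0_integralD//; [exact: nn|exact: mc|exact: nn|exact: mc].
- by rewrite ge0_integralZl_EFin//; [exact: nn|exact: mc].
- by rewrite monotone_convergence//; [move=> n; exact: mc|move=> n; exact: nn].
Qed.

Lemma monotone_functional_scale (c : R) (Phi : (S -> \bar R) -> \bar R) : 0 <= c ->
  (forall u, ge0_measurable u -> 0 <= Phi u)%E ->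
  (forall u v, ge0_measurable u -> ge0_measurable v -> (forall x, u x <= v x) ->
    Phi u <= Phi v)%E ->
  monotone_functional Phi -> monotone_functional (fun u => c%:E * Phi u)%E.
Proof.
move=> c0 Phi0 mono HPhi; split=> [u v gu gv|r u r0 gu|u_ gu nd].
- by rewrite (mfuncD HPhi)// ge0_muleDr//; exact: Phi0.
- by rewrite (mfuncZ HPhi)// muleCA.
- rewrite (mfunc_lim HPhi)// limeMl//.
  apply: ereal_nondecreasing_is_cvgn => n m nm.
  by apply: mono => // x; exact: nd.
Qed.

Lemma monotone_functional_kernel A d'' (E : measurableType d'') (Z : Omega -> E)
    (k : R.-pker E ~> S) : measurable A -> measurable_fun setT Z ->
  monotone_functional
    (fun u : S -> \bar R => \int[P]_(w in A) \int[k (Z w)]_y u y)%E.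
Proof.
move=> mA mZ.
have mc u : ge0_measurable u ->
    measurable_fun A (fun w => \int[k (Z w)]_y u y)%E.
  move=> [mu u0].
  have := measurable_fun_integral_kernel (l := k) (measurable_kernel k) u0 mu.
  move=> /measurableT_comp /(_ mZ) H.
  exact: measurable_funS H.
have kge0 u : ge0_measurable u -> forall z, (0 <= \int[k z]_y u y)%E.
  by move=> [_ u0] z; apply: integral_ge0.
have nnl u : ge0_measurable u -> forall x : S, setT x -> (0 <= u x)%E.
  by move=> [].
split=> [u v gu gv|r u r0 gu|u_ gu nd].
- under eq_integral => w _.
    rewrite ge0_integralD//; [|exact: nnl|exact: gu.1|exact: nnl|exact: gv.1].
    over.
  by rewrite ge0_integralD//; [move=> ? _; exact: kge0|exact: mc|
    move=> ? _; exact: kge0|exact: mc].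
- under eq_integral => w _.
    rewrite ge0_integralZl_EFin//; [|exact: nnl|exact: gu.1].
    over.
  by rewrite ge0_integralZl_EFin//; [move=> ? _; exact: kge0|exact: mc].
- under eq_integral => w _.
    rewrite monotone_convergence//; [|by move=> n; exact: (gu n).1|
      by move=> n x _; exact: (gu n).2].
    over.
  rewrite monotone_convergence//.
  + by move=> n; exact: mc.
  + by move=> n w _; exact: kge0.
  + move=> w _ n m nm; apply: ge0_le_integral => //.
    * exact: nnl.
    * exact: (gu n).1.
    * exact: (gu m).1.
    * by move=> x _; exact: nd.
Qed.

End functionals.

(** * Pi-lambda argument for conditional expectations *)

Section pi_lambda.
Context d (Omega : measurableType d) (R : realType) (P : probability Omega R).

(** This is the form in which an identity between conditional expectations given
    [<<s G >>] is proved: it suffices to test it on a generating pi-system. The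
    sets on which the integrals agree form a lambda-system; finiteness is what
    allows the subtraction for proper differences. *)
Lemma pi_lambda_integral (G : set (set Omega)) (F1 F2 : Omega -> \bar R) :
  setI_closed G -> G setT -> G `<=` measurable ->
  ge0_measurable F1 -> ge0_measurable F2 ->
  (\int[P]_w F1 w < +oo)%E ->
  (forall A, G A -> \int[P]_(w in A) F1 w = \int[P]_(w in A) F2 w)%E ->
  forall A, <<s G >> A ->
    measurable A /\ (\int[P]_(w in A) F1 w = \int[P]_(w in A) F2 w)%E.
Proof.
move=> GI GT Gm [mF1 F10] [mF2 F20] fin1 eqG.
have mS (F : Omega -> \bar R) A : measurable_fun setT F -> measurable_fun A F.
  by move=> mF; apply: measurable_funS mF.
have finS A : measurable A -> (\int[P]_(w in A) F1 w < +oo)%E.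
  move=> mA; apply: le_lt_trans fin1.
  by apply: ge0_subset_integral.
have splitS (F : Omega -> \bar R) A B : measurable_fun setT F ->
    (forall w, 0 <= F w)%E -> measurable A -> measurable B -> B `<=` A ->
    (\int[P]_(w in A) F w = \int[P]_(w in B) F w + \int[P]_(w in A `\` B) F w)%E.
  move=> mF F0 mA mB BA.
  rewrite -ge0_integral_setU//.
  - by rewrite setDUK.
  - exact: measurableD.
  - exact: mS.
  - by apply/disj_setPS => w [? []].
pose H : set (set Omega) := [set A | measurable A /\
  (\int[P]_(w in A) F1 w = \int[P]_(w in A) F2 w)%E].
suff sub : <<s G >> `<=` H by move=> A /sub.
apply: lambda_system_subset => //.
2:{ move=> A GA; split; [exact: Gm|exact: eqG]. }
split => //.
- by split=> //; exact: eqG.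
- move=> A B BA [mA eA] [mB eB]; split; first exact: measurableD.
  have finB : (\int[P]_(w in B) F1 w)%E \is a fin_num.
    by rewrite ge0_fin_numE ?finS//; exact: integral_ge0.
  have sub F : measurable_fun setT F -> (forall w, 0 <= F w)%E ->
      (\int[P]_(w in B) F w)%E \is a fin_num ->
      (\int[P]_(w in A `\` B) F w =
       \int[P]_(w in A) F w - \int[P]_(w in B) F w)%E.
    by move=> mF F0 fB; rewrite (splitS F A B)// addeAC subee// add0e.
  by rewrite !sub// ?eA ?eB// -eB.
- move=> A ndA HA; split; first by apply: bigcup_measurable => n _; exact: (HA n).1.
  have L (F : Omega -> \bar R) : measurable_fun setT F -> (forall w, 0 <= F w)%E ->
      (\int[P]_(w in \bigcup_n A n) F w = limn (fun n => \int[P]_(w in A n) F w))%E.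
    move=> mF F0; apply/esym/cvg_lim => //.
    apply: ge0_nondecreasing_set_cvg_integral => //.
      by move=> n; exact: (HA n).1.
    by move=> n; exact: mS.
  rewrite !L//; congr (limn _); apply/funext => n; exact: (HA n).2.
Qed.

End pi_lambda.

(** * The information carried by the state, the opponent and past randomizations *)

Section generated.
Context d (Omega : measurableType d).

Lemma generated_setI (G : set (set Omega)) : setI_closed <<s G >>.
Proof. move=> A B; exact: (@measurableI _ (g_sigma_algebraType G)). Qed.

Lemma generated_sub d1 (T1 : measurableType d1) (S : set nat)
    (Y : nat -> {mfun Omega >-> T1}) (H : set (set Omega)) :
  sigma_algebra setT H ->
  (forall k B, S k -> measurable B -> H (Y k @^-1` B)) ->
  <<s \bigcup_(k in S) preimage_set_system setT (Y k) measurable >> `<=` H.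
Proof.
move=> sH HY; apply: smallest_sub => // D [k Sk [B mB <-]].
by rewrite setTI; exact: HY.
Qed.

Lemma generated_preimage d1 (T1 : measurableType d1) (S : set nat)
    (Y : nat -> {mfun Omega >-> T1}) k B : S k -> measurable B ->
  <<s \bigcup_(k in S) preimage_set_system setT (Y k) measurable >> (Y k @^-1` B).
Proof.
move=> Sk mB; apply: sub_sigma_algebra; exists k => //; exists B => //.
by rewrite setTI.
Qed.

Lemma measurable_preimage d1 (T1 : measurableType d1) (Y : {mfun Omega >-> T1}) B :
  measurable B -> measurable (Y @^-1` B).
Proof. by move=> mB; rewrite -[X in measurable X]setTI; exact: measurable_funP. Qed.

Lemma natural_filtration_sub d1 (T1 : measurableType d1)
    (Y : nat -> {mfun Omega >-> T1}) n :
  natural_filtration Y n `<=` sigma_process Y.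
Proof.
apply: generated_sub; first exact: smallest_sigma_algebra.
by move=> k B _ mB; exact: generated_preimage.
Qed.

Lemma sigma_process_measurable d1 (T1 : measurableType d1)
    (Y : nat -> {mfun Omega >-> T1}) : sigma_process Y `<=` measurable.
Proof.
apply: generated_sub; first exact: sigma_algebra_measurable.
by move=> k B _ mB; exact: measurable_preimage.
Qed.

End generated.

Section history.
Context d (Omega : measurableType d) (R : realType).
Context d' (E : measurableType d').
Variables (X : nat -> {mfun Omega >-> E}) (eta xi : nat -> {mfun Omega >-> R}).

(** The first [m] randomizations are described by boxes rather than by the
    sigma-algebra they generate, because the mutual independence of the [xi k]
    factorizes the probability of a box directly. *)
Definition cylinder (m : nat) : set (set Omega) :=
  [set C | exists2 B : nat -> set R, (forall k, measurable (B k)) &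
     C = \bigcap_(k in `I_m) (xi k @^-1` B k)].

(** A pi-system of rectangles: on each one the independence of the three sources
    of randomness is a product formula. *)
Definition history_rect (n m : nat) : set (set Omega) :=
  [set D | exists A B C, [/\ natural_filtration X n A, sigma_process eta B,
     cylinder m C & D = A `&` B `&` C]].

(** The number [m] of observed randomizations is independent of the time [n]: just
    before randomizing at time [n] a player knows [xi 0], .., [xi n.-1] only, and
    just after, [xi n] as well. The noise [eta] of the opponent is revealed
    entirely at once, which costs nothing by independence. *)
Definition history n m := <<s history_rect n m >>.

Lemma cylinderI m : setI_closed (cylinder m).
Proof.
move=> _ _ [B mB ->] [C mC ->]; exists (fun k => B k `&` C k) => [k|].
  exact: measurableI.
by rewrite -bigcapI.
Qed.

Lemma cylinderT m : cylinder m setT.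
Proof. by exists (fun _ => setT) => //; apply/seteqP; split. Qed.

Lemma cylinder_next m B C : cylinder m C -> measurable B ->
  cylinder m.+1 (C `&` xi m @^-1` B).
Proof.
move=> [D mD ->] mB; exists (fun k => if k == m then B else D k) => [k|].
  by case: ifP.
apply/seteqP; split=> [w [Dw Bw] k /= km|w H].
  case: eqP => [->//|/eqP kneq]; apply: Dw => /=.
  by rewrite ltn_neqAle kneq -ltnS.
split=> [k /= km|]; last by have := H m (ltnSn m); rewrite eqxx.
by have := H k (ltnW km : (k < m.+1)%N); rewrite ltn_eqF.
Qed.

Lemma cylinder_sub m : cylinder m `<=` sigma_process xi.
Proof.
move=> _ [B mB ->].
apply: (@bigcap_measurableType _ (g_sigma_algebraType _)) => k _.
exact: generated_preimage.
Qed.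

Lemma setT_generated (G : set (set Omega)) : <<s G >> setT.
Proof. exact: (@measurableT _ (g_sigma_algebraType G)). Qed.

Lemma history_rectI n m : setI_closed (history_rect n m).
Proof.
move=> _ _ [A [B [C [mA mB mC ->]]]] [A' [B' [C' [mA' mB' mC' ->]]]].
exists (A `&` A'), (B `&` B'), (C `&` C'); split.
- exact: generated_setI.
- exact: generated_setI.
- exact: cylinderI.
- by apply/seteqP; split=> w /=; tauto.
Qed.

Lemma history_rectT n m : history_rect n m setT.
Proof.
exists setT, setT, setT; rewrite !setIT; split => //;
  [exact: setT_generated|exact: setT_generated|exact: cylinderT].
Qed.

Lemma history_rect_measurable n m : history_rect n m `<=` measurable.
Proof.
move=> _ [A [B [C [mA mB mC ->]]]]; apply: measurableI; first apply: measurableI.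
- exact: sigma_process_measurable (natural_filtration_sub mA).
- exact: sigma_process_measurable mB.
- exact: sigma_process_measurable (cylinder_sub mC).
Qed.

Lemma history_measurable n m : history n m `<=` measurable.
Proof.
apply: smallest_sub; [exact: sigma_algebra_measurable|exact: history_rect_measurable].
Qed.

Lemma history_state n m k B : (k <= n)%N -> measurable B ->
  history n m (X k @^-1` B).
Proof.
move=> kn mB; apply: sub_sigma_algebra; exists (X k @^-1` B), setT, setT.
by rewrite !setIT; split; [exact: generated_preimage|exact: setT_generated|
  exact: cylinderT|].
Qed.

Lemma history_noise n m k B : (k < m)%N -> measurable B ->
  history n m (xi k @^-1` B).
Proof.
move=> km mB; apply: sub_sigma_algebra; exists setT, setT, (xi k @^-1` B).
rewrite !setTI; split; [exact: setT_generated|exact: setT_generated| |by []].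
exists (fun j => if j == k then B else setT) => [j|]; first by case: ifP.
apply/seteqP; split=> [w Bw j /= _|w /(_ k km)]; last by rewrite eqxx.
by case: eqP => [->|].
Qed.

Lemma history_opponent n m A : joint_filtration X eta n A -> history n m A.
Proof.
move: A; apply: smallest_sub; first exact: smallest_sigma_algebra.
move=> D [k /= kn [[B mB <-]|[B mB <-]]]; rewrite setTI.
  exact: history_state.
apply: sub_sigma_algebra; exists setT, (eta k @^-1` B), setT.
rewrite !setIT setTI; split; [exact: setT_generated| |exact: cylinderT|by []].
exact: generated_preimage.
Qed.

Lemma history_mono n m n' m' : (n <= n')%N -> (m <= m')%N ->
  history n m `<=` history n' m'.
Proof.
move=> nn' mm'; apply: smallest_sub; first exact: smallest_sigma_algebra.
move=> _ [A [B [C [mA mB [D mD ->] ->]]]].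
apply: generated_setI; last first.
  apply: (@bigcap_measurableType _ (g_sigma_algebraType _)) => k /= km.
  by apply: history_noise => //; exact: leq_trans mm'.
apply: sub_sigma_algebra; exists A, B, setT; rewrite setIT; split=> //.
  move: A mA; apply: generated_sub; first exact: smallest_sigma_algebra.
  move=> k A /= kn mA; apply: generated_preimage => //=.
  by exact: leq_trans kn _.
exact: cylinderT.
Qed.

(** Seeing [<<s G >>] as the measurable sets of a type makes comparisons of
    measurable functions available in a sub-sigma-algebra. *)
Lemma generated_le (G : set (set Omega)) (U V : Omega -> R) :
  (forall B, measurable B -> <<s G >> (U @^-1` B)) ->
  (forall B, measurable B -> <<s G >> (V @^-1` B)) ->
  <<s G >> [set w | U w <= V w].
Proof.
move=> GU GV.
have mU : measurable_fun setT (U : g_sigma_algebraType G -> R).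
  by move=> _ B mB; rewrite setTI; exact: GU.
have mV : measurable_fun setT (V : g_sigma_algebraType G -> R).
  by move=> _ B mB; rewrite setTI; exact: GV.
have := measurable_fun_ler mU mV => /(_ measurableT [set true] I).
by rewrite setTI; congr (<<s _ >> _); apply/seteqP; split=> w.
Qed.

End history.

(** * Independence *)

Lemma ord4_cases (i : 'I_4) : [\/ i = 0, i = 1, i = 2%:R | i = 3%:R].
Proof.
by case: i => -[|[|[|[|//]]]] i4; [apply: Or41|apply: Or42|apply: Or43|apply: Or44];
  exact: val_inj.
Qed.

Section independence.
Context d (Omega : measurableType d) (R : realType) (P : probability Omega R).

Lemma independent4 (G : 4.-tuple (set_system Omega)) : mutually_independent P (tnth G) ->
  forall A : 4.-tuple (set Omega), (forall i, tnth G i (tnth A i)) ->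
  P (tnth A 0 `&` tnth A 1 `&` tnth A 2%:R `&` tnth A 3%:R) =
  (P (tnth A 0%R) * P (tnth A 1%R) * P (tnth A 2%:R) * P (tnth A 3%:R))%E.
Proof.
move=> ind A GA.
have := ind (seq_fset tt (enum 'I_4)) (tnth A) (fun i _ => GA i).
rewrite (perm_big _ (seq_fset_perm tt _)) undup_id ?enum_uniq// big_enum /=.
rewrite !big_ord_recl big_ord0 mule1 !muleA.
rewrite (_ : lift ord0 ord0 = 1)//; last exact: val_inj.
rewrite (_ : lift ord0 (lift ord0 ord0) = 2%:R)//; last exact: val_inj.
rewrite (_ : lift ord0 (lift ord0 (lift ord0 ord0)) = 3%:R)//; last exact: val_inj.
rewrite (_ : ord0 = 0)//.
move=> <-; congr (P _); apply/seteqP; split=> w; last first.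
  have J i : i \in seq_fset tt (enum 'I_4) by rewrite seq_fsetE mem_enum.
  by move=> H; split; first split; first split; exact: (H _ (J _)).
move=> [[[A0 A1] A2] A3] i _; rewrite -/(tnth A i w).
  by case: (ord4_cases i) => ->.
Qed.

Lemma independent_noise (xi : nat -> {mfun Omega >-> R}) : is_iid_uniform P xi ->
  forall m C B, cylinder xi m C -> measurable B ->
  P (C `&` xi m @^-1` B) = (P C * P (xi m @^-1` B))%E.
Proof.
move=> [_ ind] m C B cC mB.
have prodE k (D : nat -> set R) : (forall j, measurable (D j)) ->
    P (\bigcap_(j in `I_k) xi j @^-1` D j) =
    (\prod_(0 <= j < k) P (xi j @^-1` D j))%E.
  move=> mD; have := ind (seq_fset tt (index_iota 0 k)) (fun j => xi j @^-1` D j).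
  rewrite (perm_big _ (seq_fset_perm tt _)) undup_id ?iota_uniq//.
  move=> <-; last by move=> j _; exists (D j) => //; rewrite setTI.
  suff -> : [set` seq_fset tt (index_iota 0 k)] = `I_k by [].
  have J j : (j \in seq_fset tt (index_iota 0 k)) = (j < k)%N.
    by rewrite seq_fsetE mem_index_iota.
  by apply/seteqP; split=> j; rewrite /= -?J// J.
move: (cC) => [D mD CE].
have [D' mD' E'] := cylinder_next cC mB.
pose D'' j := if (j < m)%N then D j else B.
have mD'' j : measurable (D'' j) by rewrite /D''; case: ifP.
rewrite (_ : C `&` _ = \bigcap_(j in `I_m.+1) xi j @^-1` D'' j); last first.
  rewrite CE; apply/seteqP; split=> [w [Dw Bw] j /= jm|w H].
    rewrite /D''; case: ifPn => [/Dw//|]; rewrite -leqNgt => mj.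
    by rewrite (_ : j = m)//; apply/eqP; rewrite eqn_leq mj -ltnS jm.
  split=> [j jm|]; last by have := H m (ltnSn m); rewrite /D''/= ltnn.
  by have := H j (ltnW jm : (j < m.+1)%N); rewrite /D''/= jm.
rewrite prodE// big_nat_recr//= {2}/D'' ltnn CE prodE//; congr (_ * _)%E.
by apply: eq_big_nat => j /andP[_ jm]; rewrite /D'' jm.
Qed.

End independence.

Section independent_integral.
Context d (Omega : measurableType d) (R : realType) (P : probability Omega R).
Context d' (S : measurableType d').

Lemma pr_integral_indic A B : measurable A -> measurable B ->
  (\int[P]_(w in A) (\1_B w)%:E)%E = P (A `&` B).
Proof. by move=> mA mB; rewrite integral_indic// setIC. Qed.

Lemma pr_integral_cst A (r : R) : measurable A ->
  (\int[P]_(w in A) r%:E)%E = (r%:E * P A)%E.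
Proof. by move=> mA; rewrite integral_cst. Qed.

Lemma integral_indic_comp A (Y : Omega -> S) B :
  measurable_fun setT Y -> measurable A -> measurable B ->
  (\int[P]_(w in A) (EFin \o \1_B) (Y w))%E = P (A `&` Y @^-1` B).
Proof.
move=> mY mA mB.
have mYB : measurable (Y @^-1` B) by rewrite -[X in measurable X]setTI; exact: mY.
rewrite (_ : (fun w => _) = (fun w => (\1_(Y @^-1` B) w)%:E)).
  by rewrite integral_indic// 1?setIC.
by apply/funext => w /=; rewrite !indicE; congr ((nat_of_bool _)%:R)%:E;
  apply/idP/idP; rewrite !inE.
Qed.

(** Serves for the noise of both players, and for survival, where [D] is the event
    of not having been killed yet. *)
Lemma independent_integral A D (Y : {mfun Omega >-> S}) :
  measurable A -> measurable D ->
  (forall B, measurable B -> P (A `&` Y @^-1` B `&` D) = P (A `&` Y @^-1` B) * P D)%E ->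
  forall u, ge0_measurable u ->
    (\int[P]_(w in A `&` D) u (Y w) = P D * \int[P]_(w in A) u (Y w))%E.
Proof.
move=> mA mD ind.
have mY : measurable_fun setT Y by [].
have PD : P D = (fine (P D))%:E by rewrite fineK// fin_num_measure.
rewrite PD; apply: monotone_functional_ext.
- by apply: monotone_functional_comp => //; exact: measurableI.
- apply: monotone_functional_scale.
  + exact: fine_ge0.
  + by move=> u [_ u0]; exact: integral_ge0.
  + move=> u v gu gv uv; apply: ge0_le_integral => //.
    * by move=> w _; exact: gu.2.
    * by apply: measurable_funS (measurableT_comp gu.1 mY).
    * by apply: measurable_funS (measurableT_comp gv.1 mY).
  + exact: monotone_functional_comp.
- move=> B mB; rewrite !integral_indic_comp//; last exact: measurableI.
  by rewrite -PD muleC -ind// setIAC.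
Qed.

End independent_integral.

Section markov_noise.
Context d (Omega : measurableType d) (R : realType) (P : probability Omega R).
Context d' (E : measurableType d') (Pi : R.-pker E ~> E).
Variables (X : nat -> {mfun Omega >-> E}) (eta xi : nat -> {mfun Omega >-> R}).
Variable x : E.
Hypothesis markov : is_markov_process P Pi X x.
Hypothesis iid : is_iid_uniform P xi.
Hypothesis ind : forall A B C, sigma_process X A -> sigma_process eta B ->
  sigma_process xi C -> P (A `&` B `&` C) = (P A * P B * P C)%E.

Lemma integral_initial u : ge0_measurable u -> (\int[P]_w u (X 0%N w) = u x)%E.
Proof.
move=> gu; have mX : measurable_fun setT (X 0%N) by [].
transitivity (\int[\d_x]_y u y)%E; last first.
  by rewrite integral_dirac// ?diracT ?mul1e//; exact: gu.1.
have := ge0_integral_pushforward mX P measurableT gu.1 (fun y _ => gu.2 y).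
rewrite preimage_setT => <-.
by apply: eq_measure_integral => B mB _; exact: markov.1.
Qed.

(** The product formulas hold on rectangles, and a pi-lambda argument extends them
    to the whole past. *)
Lemma independent_noise_history n m A B : history X eta xi n m A -> measurable B ->
  P (A `&` xi m @^-1` B) = (P A * P (xi m @^-1` B))%E.
Proof.
move=> hA mB.
have mxi : measurable (xi m @^-1` B) by exact: measurable_preimage.
have [c0 cE] : (0 <= P (xi m @^-1` B))%E /\
    P (xi m @^-1` B) = (fine (P (xi m @^-1` B)))%:E.
  by split=> //; rewrite fineK// fin_num_measure.
suff H : measurable A /\ (\int[P]_(w in A) (\1_(xi m @^-1` B) w)%:E =
    \int[P]_(w in A) (fine (P (xi m @^-1` B)))%:E)%E.
  by case: H => mA; rewrite pr_integral_indic// pr_integral_cst// -cE muleC.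
move: A hA; apply: pi_lambda_integral.
- exact: history_rectI.
- exact: history_rectT.
- exact: history_rect_measurable.
- split; last by move=> w; rewrite lee_fin.
  exact/measurable_EFinP/measurable_indic.
- by split; [exact: measurable_cst|move=> w; rewrite -cE].
- by rewrite pr_integral_indic// setTI cE ltry.
- move=> _ [A [B' [C [mA mB' mC ->]]]].
  have sA := natural_filtration_sub mA.
  have sC := cylinder_sub mC.
  have mD : measurable (A `&` B' `&` C).
    by apply: (@history_rect_measurable _ _ _ _ _ X eta xi n m); exists A, B', C; split.
  rewrite pr_integral_indic// pr_integral_cst//.
  rewrite -(setIA (A `&` B') C) ind//.
    by rewrite (independent_noise iid)// ind// -cE [RHS]muleC !muleA.
  by apply: generated_setI => //; exact: generated_preimage.
Qed.

End markov_noise.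

(** * The stopping probability of a randomized time *)

Section restricted_law.
Context d (Omega : measurableType d) (R : realType) (P : probability Omega R).
Context d' (S : measurableType d') (A : set Omega) (Y : Omega -> S).
Hypotheses (mA : measurable A) (mY : measurable_fun setT Y).

(** The law of [Y] on the event [A], as a finite (not a probability) measure; the
    proofs of measurability are arguments so that it carries a measure structure. *)
Definition restricted_law of measurable A & measurable_fun setT Y :=
  fun B => P (A `&` Y @^-1` B).
Let law := restricted_law mA mY.

Let mpre B : measurable B -> measurable (Y @^-1` B).
Proof. by move=> mB; rewrite -[X in measurable X]setTI; exact: mY. Qed.

Let law0 : law set0 = 0%E.
Proof. by rewrite /law /restricted_law preimage_set0 setI0 measure0. Qed.

Let law_ge0 B : (0 <= law B)%E.
Proof. exact: measure_ge0. Qed.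

Let law_sigma_additive : semi_sigma_additive law.
Proof.
move=> F mF tF mUF; rewrite /law /restricted_law preimage_bigcup setI_bigcupr.
apply: measure_semi_sigma_additive.
- by move=> n; apply: measurableI => //; exact: mpre.
- apply/trivIsetP => /= i j _ _ ij; rewrite setIACA -preimage_setI.
  by move/trivIsetP : tF => /(_ _ _ _ _ ij) ->//; rewrite preimage_set0 setI0.
- rewrite -setI_bigcupr -preimage_bigcup; apply: measurableI => //.
  exact: mpre.
Qed.

HB.instance Definition _ :=
  isMeasure.Build _ _ _ law law0 law_ge0 law_sigma_additive.

Let law_finite : fin_num_fun law.
Proof.
move=> B mB; apply: fin_num_measure; apply: measurableI => //.
exact: mpre.
Qed.

HB.instance Definition _ := @Measure_isFinite.Build _ S R law law_finite.

Lemma integral_restricted_law u : ge0_measurable u ->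
  (\int[law]_y u y = \int[P]_(w in A) u (Y w))%E.
Proof.
move: u; apply: monotone_functional_ext.
- exact: (monotone_functional_comp law measurableT (@measurable_id _ _ setT)).
- exact: monotone_functional_comp.
- move=> B mB; rewrite integral_indic// setIT.
  by rewrite integral_indic_comp.
Qed.

End restricted_law.

Section randomization.
Context d (Omega : measurableType d) (R : realType) (P : probability Omega R).
Context d' (E : measurableType d').
Variables (X : nat -> {mfun Omega >-> E}) (eta xi : nat -> {mfun Omega >-> R}).
Hypothesis iid : is_iid_uniform P xi.
Hypothesis ind : forall A B C, sigma_process X A -> sigma_process eta B ->
  sigma_process xi C -> P (A `&` B `&` C) = (P A * P B * P C)%E.

Lemma uniform_prob_le (r : R) : 0 <= r <= 1 ->
  uniform_prob (@ltr01 R) [set y | y <= r] = r%:E.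
Proof.
move=> /andP[r0 r1].
have -> : [set y | y <= r] = `]-oo, r]%classic :> set R.
  by apply/seteqP; split => y /=; rewrite in_itv.
rewrite /uniform_prob integral_uniform_pdf.
rewrite (_ : _ `&` _ = `[0, r]%classic); last first.
  apply/seteqP; split => y /=; rewrite !in_itv/=; first by move=> [-> /andP[-> _]].
  by move=> /andP[-> yr]; rewrite yr (le_trans yr r1).
rewrite (eq_integral (fun=> 1%:E)); last first.
  move=> y; rewrite inE/= in_itv/= /uniform_pdf => /andP[-> yr].
  by rewrite (le_trans yr r1)/= subr0 invr1.
rewrite integral_cst//= mul1e lebesgue_measure_itv/= lte_fin.
by case: ltP => [_|r0']; [rewrite sube0|congr (_%:E); apply/eqP; rewrite eq_le r0].
Qed.

(** Given the past, the player stops with conditional probability [p (X n)]. On an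
    event [A] of the past the pair [(X n, xi n)] has a product law, so the
    identity is Tonelli's theorem for the region below the graph of [p]. *)
Lemma integral_randomization n A (p : E -> R) u : history X eta xi n n A ->
  measurable_fun setT p -> (forall y, 0 <= p y <= 1) -> ge0_measurable u ->
  (\int[P]_(w in A `&` [set w | (xi n w <= p (X n w))%R]) u (X n w) =
   \int[P]_(w in A) ((p (X n w))%:E * u (X n w)))%E.
Proof.
move=> hA mp p01 [mu u0].
have mA := history_measurable hA.
have mX : measurable_fun setT (X n) by [].
have mxi : measurable_fun setT (xi n) by [].
have mY : measurable_fun setT (fun w => (X n w, xi n w)).
  exact: measurable_fun_pair.
pose C : set (E * R) := [set z | z.2 <= p z.1].
have mC : measurable C.
  have := measurable_fun_ler (measurable_snd : measurable_fun setT (@snd E R))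
    (measurableT_comp mp (measurable_fst : measurable_fun setT (@fst E R))).
  move=> /(_ measurableT [set true] I); rewrite setTI.
  by congr measurable; apply/seteqP; split => z.
pose F (z : E * R) := (u z.1 * (\1_C z)%:E)%E.
have gF : ge0_measurable F.
  split; last by move=> z; apply: mule_ge0; rewrite ?u0// lee_fin.
  apply: emeasurable_funM.
    exact: (measurableT_comp mu (measurable_fst : measurable_fun setT (@fst E R))).
  exact/measurable_EFinP/measurable_indic.
transitivity (\int[P]_(w in A) F (X n w, xi n w))%E.
  rewrite integral_mkcondr; apply: eq_integral => w _.
  rewrite patchE /F indicE.
  suff -> : ((X n w, xi n w) \in C) = (w \in [set w | (xi n w <= p (X n w))%R]).
    by case: ifP; rewrite ?mule1 ?mule0.
  by apply/idP/idP; rewrite !inE.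
rewrite -(integral_restricted_law P mA mY gF).
pose law := restricted_law P mA mX.
pose unif := restricted_law P measurableT mxi.
transitivity (\int[law \x unif]_z F z)%E.
  apply: eq_measure_integral => B mB _; apply/esym.
  apply: product_measure_unique => // B1 B2 mB1 mB2.
  transitivity (P (A `&` X n @^-1` B1 `&` xi n @^-1` B2)).
    by rewrite /restricted_law; congr (P _); apply/seteqP; split=> w /=; tauto.
  rewrite (independent_noise_history iid ind (n := n))//.
    by congr (_ * P _)%E; rewrite setTI.
  by apply: generated_setI => //; exact: history_state.
rewrite fubini_tonelli1//; [|exact: gF.1|exact: gF.2].
rewrite -(integral_restricted_law P mA mX (u := fun y => ((p y)%:E * u y)%E)).
  apply: eq_integral => y _; rewrite /fubini_F /F/=.
  have my : measurable [set r : R | r <= p y].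
    have -> : [set r : R | r <= p y] = `]-oo, p y]%classic :> set R; last by [].
    by apply/seteqP; split => z /=; rewrite in_itv.
  rewrite ge0_integralZl//.
  - rewrite (eq_integral (fun r => (\1_[set r : R | r <= p y] r)%:E)); last first.
      by move=> r _; rewrite !indicE; congr ((nat_of_bool _)%:R)%:E;
        apply/idP/idP; rewrite !inE.
    rewrite integral_indic// setIT.
    transitivity (u y * P (xi n @^-1` [set r : R | (r <= p y)%R]))%E.
      by congr (_ * P _)%E; rewrite setTI.
    by rewrite iid.1// uniform_prob_le// muleC.
  - apply/measurable_EFinP.
    rewrite (_ : (fun _ => _) = \1_[set r : R | r <= p y]); first exact: measurable_indic.
    by apply/funext => r; rewrite !indicE; congr ((nat_of_bool _)%:R);
      apply/idP/idP; rewrite !inE.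
split.
  by apply: emeasurable_funM => //; exact/measurable_EFinP.
by move=> y; rewrite mule_ge0// lee_fin; have /andP[] := p01 y.
Qed.

End randomization.

(** * Markov property given the enlarged history *)

Section markov_step.
Context d (Omega : measurableType d) (R : realType) (P : probability Omega R).
Context d' (E : measurableType d') (Pi : R.-pker E ~> E).
Variables (X : nat -> {mfun Omega >-> E}) (eta xi : nat -> {mfun Omega >-> R}).
Variable x : E.
Hypothesis markov : is_markov_process P Pi X x.
Hypothesis ind : forall A B C, sigma_process X A -> sigma_process eta B ->
  sigma_process xi C -> P (A `&` B `&` C) = (P A * P B * P C)%E.

(** The Markov property is given for the natural filtration of [X]; it persists
    when independent noise is added to the past. *)
Lemma markov_history n m A u : history X eta xi n m A -> ge0_measurable u ->
  (\int[P]_(w in A) u (X n.+1 w) = \int[P]_(w in A) \int[Pi (X n w)]_y u y)%E.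
Proof.
move=> hA; have mA := history_measurable hA.
move: u; apply: monotone_functional_ext.
- exact: monotone_functional_comp.
- exact: monotone_functional_kernel.
move=> B mB; rewrite integral_indic_comp//.
under eq_integral => w _ do rewrite integral_indic// setIT.
have mk : ge0_measurable (fun y => Pi y B) by split=> //; exact: measurable_kernel.
have mXn : measurable_fun setT (X n) by [].
have mXB : measurable (X n.+1 @^-1` B) by exact: measurable_preimage.
suff H : measurable A /\ (\int[P]_(w in A) (\1_(X n.+1 @^-1` B) w)%:E =
    \int[P]_(w in A) Pi (X n w) B)%E.
  by rewrite -H.2 pr_integral_indic.
move: A hA {mA}; apply: pi_lambda_integral.
- exact: history_rectI.
- exact: history_rectT.
- exact: history_rect_measurable.
- split; last by move=> w; rewrite lee_fin.
  exact/measurable_EFinP/measurable_indic.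
- by split=> [|w]; [exact: measurableT_comp mk.1 mXn|exact: mk.2].
- rewrite pr_integral_indic// setTI -ge0_fin_numE//; exact: fin_num_measure.
- move=> _ [A [B' [C [fA mB' mC ->]]]].
  have sA := natural_filtration_sub fA.
  have sC := cylinder_sub mC.
  have mA : measurable A by exact: sigma_process_measurable sA.
  have mBC : measurable (B' `&` C).
    apply: measurableI; first exact: sigma_process_measurable mB'.
    exact: sigma_process_measurable sC.
  have indA A' : sigma_process X A' -> P (A' `&` (B' `&` C)) = (P A' * P (B' `&` C))%E.
    have sT : sigma_process X setT by exact: setT_generated.
    have := ind sT mB' sC.
    by rewrite setTI probability_setT mul1e => -> sA'; rewrite setIA ind// muleA.
  rewrite -setIA pr_integral_indic//; last exact: measurableI.
  rewrite setIAC indA; last first.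
    by apply: generated_setI => //; exact: generated_preimage.
  rewrite markov.2//.
  rewrite (independent_integral (Y := X n) mA mBC _ mk); first by rewrite muleC.
  move=> B'' mB''; apply: indA; apply: generated_setI => //.
  exact: generated_preimage.
Qed.

Lemma markov_step n u : ge0_measurable u ->
  (\int[P]_w u (X n.+1 w) = \int[P]_w \int[Pi (X n w)]_y u y)%E.
Proof. by move=> gu; apply: (@markov_history n 0%N) => //; exact: setT_generated. Qed.

End markov_step.

(** * Smallest excessive majorant *)

Section excessive.
Context d' (E : measurableType d') (R : realType) (Pi : R.-pker E ~> E) (alpha : R).
Hypothesis alpha0 : 0 <= alpha.

(** The value of optimally stopping the discounted reward [phi] within [n] steps. *)
Fixpoint stopping_value (phi : E -> \bar R) (n : nat) : E -> \bar R :=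
  if n is k.+1 then
    fun y => maxe (phi y) (alpha%:E * \int[Pi y]_z stopping_value phi k z)%E
  else phi.

Definition excessive_majorant (phi : E -> \bar R) (y : E) : \bar R :=
  limn (stopping_value phi ^~ y).

Lemma ge0_measurable_kernel u : ge0_measurable u ->
  ge0_measurable (fun y => \int[Pi y]_z u z)%E.
Proof.
move=> [mu u0]; split; last by move=> y; exact: integral_ge0.
exact: (measurable_fun_integral_kernel (l := Pi) (measurable_kernel Pi) u0 mu).
Qed.

Lemma ge0_le_kernel u v y : ge0_measurable u -> ge0_measurable v ->
  (forall z, u z <= v z)%E -> (\int[Pi y]_z u z <= \int[Pi y]_z v z)%E.
Proof.
move=> [mu u0] [mv v0] uv; exact: ge0_le_integral.
Qed.

Variable phi : E -> \bar R.
Hypothesis gphi : ge0_measurable phi.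

Lemma stopping_value_ge0_measurable n : ge0_measurable (stopping_value phi n).
Proof.
elim: n => [//|n IH]; have [mk k0] := ge0_measurable_kernel IH.
split=> [|y] /=; first by apply: measurable_maxe gphi.1 _; exact: measurable_funeM.
by rewrite le_max gphi.2.
Qed.

Lemma stopping_value_nd y : {homo stopping_value phi ^~ y : n m / (n <= m)%N >-> (n <= m)%E}.
Proof.
apply: homo_leq => [//|x z w /le_trans|n]; first exact.
elim: n y => [|n IH] y; first by rewrite /= le_max lexx.
rewrite [leLHS]/= [leRHS]/= ge_max !le_max lexx/=; apply/orP; right.
apply: lee_wpmul2l => //.
by apply: ge0_le_kernel IH; [exact: stopping_value_ge0_measurable|
  exact: (stopping_value_ge0_measurable n.+1)].
Qed.

Lemma stopping_value_cvg y : cvgn (stopping_value phi ^~ y).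
Proof. by apply: ereal_nondecreasing_is_cvgn; exact: stopping_value_nd. Qed.

Lemma stopping_value_le n y : (stopping_value phi n y <= excessive_majorant phi y)%E.
Proof.
by apply: lime_ge; [exact: stopping_value_cvg|near=> m; apply: stopping_value_nd;
  near: m; exact: nbhs_infty_ge].
Unshelve. all: by end_near. Qed.

Lemma excessive_majorant_ge0_measurable : ge0_measurable (excessive_majorant phi).
Proof.
split.
  apply: (emeasurable_fun_cvg (stopping_value phi)) => [n|y _].
    by have [] := stopping_value_ge0_measurable n.
  exact: stopping_value_cvg.
by move=> y; apply: le_trans (stopping_value_le 0%N y); exact: gphi.2.
Qed.

Lemma excessive_majorant_ge y : (phi y <= excessive_majorant phi y)%E.
Proof. exact: (stopping_value_le 0%N). Qed.

Lemma excessive_majorant_excessive y :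
  (alpha%:E * \int[Pi y]_z excessive_majorant phi z <= excessive_majorant phi y)%E.
Proof.
rewrite /excessive_majorant monotone_convergence//; first last.
- by move=> z _; exact: stopping_value_nd.
- by move=> n z _; exact: (stopping_value_ge0_measurable n).2.
- by move=> n; exact: (stopping_value_ge0_measurable n).1.
have cvgI : cvgn (fun n => \int[Pi y]_z stopping_value phi n z)%E.
  apply: ereal_nondecreasing_is_cvgn => n m nm; apply: ge0_le_kernel.
  - exact: stopping_value_ge0_measurable.
  - exact: stopping_value_ge0_measurable.
  - by move=> z; exact: stopping_value_nd.
rewrite -limeMl//; apply: lime_le; first exact: is_cvgeMl.
near=> n; apply: le_trans (stopping_value_le n.+1 y).
by rewrite /= le_max lexx orbT.
Unshelve. all: by end_near. Qed.

End excessive.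

Section killed_bound.
Context d (Omega : measurableType d) (R : realType) (P : probability Omega R).
Context d' (E : measurableType d') (Pi : R.-pker E ~> E) (alpha : R).
Variables (X : nat -> {mfun Omega >-> E}) (eta xi : nat -> {mfun Omega >-> R}).
Variables (T : {mfun Omega >-> nat}) (x : E) (phi : E -> \bar R) (W : Omega -> \bar R).
Hypothesis alpha0 : 0 <= alpha.
Hypothesis markov : is_markov_process P Pi X x.
Hypothesis ind : forall A B C, sigma_process X A -> sigma_process eta B ->
  sigma_process xi C -> P (A `&` B `&` C) = (P A * P B * P C)%E.
Hypothesis survival : forall A m, sigma_process X A ->
  (P (A `&` [set w | (m <= T w)%N]) = P A * (alpha ^+ m)%:E)%E.
Hypothesis gphi : ge0_measurable phi.
Hypothesis gW : ge0_measurable W.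
Hypothesis phiW : forall m w, (m <= T w)%N -> (phi (X m w) <= W w)%E.

Lemma history_filtration n m A : natural_filtration X n A -> history X eta xi n m A.
Proof.
move: A; apply: generated_sub; first exact: smallest_sigma_algebra.
by move=> k B /= kn mB; apply: history_state => //; rewrite -ltnS.
Qed.

Lemma measurable_survival m : measurable [set w | (m <= T w)%N].
Proof. exact: (measurable_preimage T (B := [set k | (m <= k)%N])). Qed.

Lemma survival_integral m A u : natural_filtration X m A -> ge0_measurable u ->
  (\int[P]_(w in A `&` [set w | (m <= T w)%N]) u (X m w) =
   (alpha ^+ m)%:E * \int[P]_(w in A) u (X m w))%E.
Proof.
move=> fA gu; have mA := sigma_process_measurable (natural_filtration_sub fA).
have PT : P [set w | (m <= T w)%N] = (alpha ^+ m)%:E.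
  have sT : sigma_process X setT by exact: setT_generated.
  by have := survival m sT; rewrite setTI probability_setT mul1e.
rewrite (independent_integral (Y := X m) mA (measurable_survival m) _ gu).
  by rewrite PT.
move=> B mB; rewrite survival ?PT//.
by apply: generated_setI; [exact: natural_filtration_sub fA|exact: generated_preimage].
Qed.

(** Discounting is killing: at the time [m] of stopping, [alpha ^+ m] is the
    probability that the killed process is still alive, and then the reward is at
    most [W]. Backward induction avoids naming the optimal stopping time: the
    event [A] is split according to whether stopping is optimal at [X m]. *)
Lemma stopping_value_killed n m A : natural_filtration X m A ->
  ((alpha ^+ m)%:E * \int[P]_(w in A) stopping_value Pi alpha phi n (X m w) <=
   \int[P]_(w in A `&` [set w | (m <= T w)%N]) W w)%E.
Proof.
have mX k : measurable_fun setT (X k) by [].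
have subW (C D : set Omega) : measurable C -> measurable D -> C `<=` D ->
    (\int[P]_(w in C) W w <= \int[P]_(w in D) W w)%E.
  move=> mC mD CD; apply: ge0_subset_integral => //.
    exact: measurable_funS gW.1.
  by move=> w _; exact: gW.2.
have stop k A' : natural_filtration X k A' ->
    ((alpha ^+ k)%:E * \int[P]_(w in A') phi (X k w) <=
     \int[P]_(w in A' `&` [set w | (k <= T w)%N]) W w)%E.
  move=> fA; have mA := sigma_process_measurable (natural_filtration_sub fA).
  rewrite -survival_integral//; apply: ge0_le_integral => //.
  - by apply: measurableI => //; exact: measurable_survival.
  - by move=> w _; exact: gphi.2.
  - apply: measurable_funS (measurableT_comp gphi.1 (mX k)) => //.
  - exact: measurable_funS gW.1.
  - by move=> w [_ /=]; exact: phiW.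
elim: n m A => [|n IH] m A fA; first exact: stop.
have gS := stopping_value_ge0_measurable Pi alpha gphi n.
have [mk k0] := ge0_measurable_kernel Pi gS.
(* the stopping region with n.+1 steps to go *)
pose C := [set y | (alpha%:E * \int[Pi y]_z stopping_value Pi alpha phi n z <= phi y)%E].
have mC : measurable C.
  rewrite -[C]setTI; apply: emeasurable_fun_le => //; last exact: gphi.1.
  exact: measurable_funeM.
pose A1 := A `&` X m @^-1` C; pose A2 := A `&` X m @^-1` (~` C).
have fA1 : natural_filtration X m A1.
  by apply: generated_setI => //; apply: generated_preimage => //=.
have fA2 : natural_filtration X m A2.
  apply: generated_setI => //; apply: generated_preimage => //=.
  exact: measurableC.
have mA1 := sigma_process_measurable (natural_filtration_sub fA1).
have mA2 := sigma_process_measurable (natural_filtration_sub fA2).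
have A12 : A = A1 `|` A2.
  by rewrite -setIUr preimage_setC setUv setIT.
have d12 : [disjoint A1 & A2] by apply/disj_setPS => w [[_ ?] [_ ?]].
have mT := measurable_survival.
have mS : measurable_fun A (fun w => stopping_value Pi alpha phi n.+1 (X m w)).
  have := measurableT_comp (stopping_value_ge0_measurable Pi alpha gphi n.+1).1 (mX m).
  exact: measurable_funS.
rewrite {1}A12 ge0_integral_setU//; first last.
- by move=> w _; apply: (stopping_value_ge0_measurable Pi alpha gphi n.+1).2.
- by rewrite -A12.
rewrite A12 setIUl ge0_integral_setU//; first last.
- by apply/disj_setPS => w [[[_ ?] _] [[_ ?] _]].
- by move=> w _; exact: gW.2.
- exact: measurable_funS gW.1.
- exact: measurableI.
- exact: measurableI.
rewrite ge0_muleDr; try by apply: integral_ge0 => w _;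
  apply: (stopping_value_ge0_measurable Pi alpha gphi n.+1).2.
apply: leeD.
  apply: le_trans (stop m A1 fA1).
  rewrite le_eqVlt; apply/orP; left; apply/eqP; congr (_ * _)%E.
  by apply: eq_integral => w; rewrite inE => -[_ Cw]; rewrite /= max_l.
have fA2' : natural_filtration X m.+1 A2.
  move: A2 fA2 {mA2 A12 d12}; apply: generated_sub; first exact: smallest_sigma_algebra.
  by move=> k B /= kn mB; apply: generated_preimage => //=; exact: ltnW.
have := IH m.+1 A2 fA2'.
rewrite (markov_history markov ind (@history_filtration m 0 A2 fA2) gS) => step.
apply: le_trans (le_trans step _); last first.
  by apply: subW; [exact: measurableI|exact: measurableI|
    by move=> w [A2w /=] mT'; split=> //=; exact: ltnW].
rewrite exprSr EFinM -muleA.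
rewrite -[X in (_ <= _ * X)%E]ge0_integralZl_EFin//; last first.
  by apply: measurable_funS (measurableT_comp mk (mX m)).
rewrite le_eqVlt; apply/orP; left; apply/eqP; congr (_ * _)%E.
apply: eq_integral => w; rewrite inE => -[_ Cw]; rewrite /= max_r//.
by move/negP: Cw; rewrite -ltNge => /ltW.
Qed.

(** For [m = 0] this bounds the majorant by an integrable quantity, hence shows it
    finite; for large [m] it makes the discounted majorant vanish. *)
Lemma excessive_majorant_killed m :
  ((alpha ^+ m)%:E * \int[P]_w excessive_majorant Pi alpha phi (X m w) <=
   \int[P]_(w in [set w | (m <= T w)%N]) W w)%E.
Proof.
have gS n := stopping_value_ge0_measurable Pi alpha gphi n.
have mX : measurable_fun setT (X m) by [].
rewrite /excessive_majorant monotone_convergence//; first last.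
- by move=> w _; exact: stopping_value_nd.
- by move=> n w _; exact: (gS n).2.
- by move=> n; exact: measurableT_comp (gS n).1 mX.
have cvgI : cvgn (fun n => \int[P]_w stopping_value Pi alpha phi n (X m w))%E.
  apply: ereal_nondecreasing_is_cvgn => n k nk; apply: ge0_le_integral => //.
  - by move=> w _; exact: (gS n).2.
  - exact: measurableT_comp (gS n).1 mX.
  - exact: measurableT_comp (gS k).1 mX.
  - by move=> w _; exact: stopping_value_nd.
rewrite -limeMl//; apply: lime_le; first exact: is_cvgeMl.
near=> n; have fT : natural_filtration X m setT by exact: setT_generated.
by have := stopping_value_killed n fT; rewrite setTI.
Unshelve. all: by end_near. Qed.

End killed_bound.

(** * A vanishing majorant of the payoffs *)

Section sources.
Context d (Omega : measurableType d) (R : realType) (P : probability Omega R).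
Context d' (E : measurableType d').
Variables (X : nat -> {mfun Omega >-> E}) (xi1 xi2 : nat -> {mfun Omega >-> R}).
Variables (T : {mfun Omega >-> nat}) (alpha : R).
Hypothesis indep : independent_sources P X xi1 xi2 T.

Lemma independent_sources4 A B C D : sigma_process X A -> sigma_process xi1 B ->
  sigma_process xi2 C -> measurable D ->
  P (A `&` B `&` C `&` T @^-1` D) = (P A * P B * P C * P (T @^-1` D))%E.
Proof.
move=> sA sB sC mD.
have := independent4 indep (A := [tuple A; B; C; T @^-1` D]); apply.
move=> i; case: (ord4_cases i) => -> //.
by exists D => //; rewrite setTI.
Qed.

Lemma independent_sources3 A B C : sigma_process X A -> sigma_process xi1 B ->
  sigma_process xi2 C -> P (A `&` B `&` C) = (P A * P B * P C)%E.
Proof.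
move=> sA sB sC; have := independent_sources4 sA sB sC measurableT.
by rewrite preimage_setT setIT probability_setT mule1.
Qed.

Lemma independent_sources3_swap A B C : sigma_process X A -> sigma_process xi2 B ->
  sigma_process xi1 C -> P (A `&` B `&` C) = (P A * P B * P C)%E.
Proof. by move=> sA sB sC; rewrite setIAC independent_sources3// muleAC. Qed.

Hypothesis killT : is_killing_time P alpha T.

Lemma killing_survival m : P [set w | (m <= T w)%N] = (alpha ^+ m)%:E.
Proof.
elim: m => [|m IH].
  by rewrite expr0 -[RHS](probability_setT P); congr (P _); apply/seteqP; split.
have mT k := measurable_survival T k.
have split : [set w | (m <= T w)%N] = T @^-1` [set m] `|` [set w | (m.+1 <= T w)%N].
  apply/seteqP; split=> w /=; first by rewrite leq_eqVlt => /predU1P[->|]; [left|right].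
  by case=> [->//|/ltnW].
have survE : (alpha ^+ m)%:E = (((1 - alpha) * alpha ^+ m)%:E +
    P [set w | (m.+1 <= T w)%N])%E.
  rewrite -IH split measureU//; first by rewrite -killT.
    exact: measurable_preimage.
  by apply/seteqP; split=> w //= -[->]; rewrite ltnn.
have fin : P [set w | (m.+1 <= T w)%N] \is a fin_num by exact: fin_num_measure.
rewrite -(fineK fin) -EFinD in survE *; congr (_%:E).
case: survE => survE; rewrite exprS; nra.
Qed.

Lemma independent_survival A m : sigma_process X A ->
  (P (A `&` [set w | (m <= T w)%N]) = P A * (alpha ^+ m)%:E)%E.
Proof.
move=> sA; rewrite -killing_survival.
have s1 : sigma_process xi1 setT by exact: setT_generated.
have s2 : sigma_process xi2 setT by exact: setT_generated.
have mD : measurable [set k : nat | (m <= k)%N] by [].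
by have := independent_sources4 sA s1 s2 mD; rewrite !setIT probability_setT !mule1.
Qed.

End sources.

Section majorant.
Context (R : realType) d d' (Omega : measurableType d) (E : measurableType d').
Variables (Pi : R.-pker E ~> E) (P : E -> probability Omega R).
Variables (X : nat -> {mfun Omega >-> E}) (alpha : R) (f g h : E -> R).

(** An alpha-excessive bound of the payoffs that vanishes along the discounted
    chain: the substitute for boundedness in all limits below. *)
Record majorant (M : E -> R) : Prop := Majorant {
  majorant_measurable : measurable_fun setT M ;
  majorant_f : forall y, `|f y| <= M y ;
  majorant_g : forall y, `|g y| <= M y ;
  majorant_h : forall y, `|h y| <= M y ;
  majorant_excessive :
    forall y, (alpha%:E * \int[Pi y]_z (M z)%:E <= (M y)%:E)%E ;
  majorant_vanishes : forall x,
    ((alpha ^+ n)%:E * \int[P x]_w (M (X n w))%:E)%E @[n --> \oo] --> 0%E }.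

End majorant.

Section majorant_exists.
Context (R : realType) d d' (Omega : measurableType d) (E : measurableType d').
Variables (Pi : R.-pker E ~> E) (P : E -> probability Omega R).
Variables (X : nat -> {mfun Omega >-> E}) (xi1 xi2 : nat -> {mfun Omega >-> R}).
Variables (T : {mfun Omega >-> nat}) (alpha : R) (f g h : {mfun E >-> R}).
Hypothesis alpha0 : 0 <= alpha.
Hypothesis markovX : forall x, is_markov_process (P x) Pi X x.
Hypothesis killT : forall x, is_killing_time (P x) alpha T.
Hypothesis indep : forall x, independent_sources (P x) X xi1 xi2 T.

Let sup_killed (u : E -> R) (w : Omega) :=
  ereal_sup (range (fun n => `|oapp u 0 (killed X T n w)|%:E)).

Let sup_killed_ge0 u w : (0 <= sup_killed u w)%E.
Proof. by apply: ereal_sup_ge; exists `|oapp u 0 (killed X T 0%N w)|%:E;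
  [exists 0%N|rewrite lee_fin]. Qed.

Let sup_killed_ge u m w : (m <= T w)%N -> (`|u (X m w)|%:E <= sup_killed u w)%E.
Proof.
by move=> mT; apply: ereal_sup_ubound; exists m => //; rewrite /killed mT.
Qed.

(** The killing time is finite, so the events [n <= T] decrease to the empty set. *)
Lemma integral_survival_cvg0 (P0 : probability Omega R) (W : Omega -> \bar R) :
  ge0_measurable W -> (\int[P0]_w W w < +oo)%E ->
  (\int[P0]_(w in [set w | (n <= T w)%N]) W w)%E @[n --> \oo] --> 0%E.
Proof.
move=> [mW W0] finW.
have mWS D : measurable_fun D W by exact: measurable_funS mW.
pose D n := ~` [set w | (n <= T w)%N].
have mT n := measurable_survival T n.
have mD n : measurable (D n) by apply: measurableC.
have UD : \bigcup_n D n = setT.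
  by apply/seteqP; split=> // w _; exists (T w).+1 => //; rewrite /D /= ltnn.
have cD : (\int[P0]_(w in D n) W w)%E @[n --> \oo] --> (\int[P0]_w W w)%E.
  rewrite -[X in _ --> (\int[P0]_(w in X) _)%E]UD.
  apply: ge0_nondecreasing_set_cvg_integral => //.
  move=> n m nm; apply/subsetPset => w /= nT mTw.
  by apply: nT; exact: leq_trans mTw.
have finI : (\int[P0]_w W w)%E \is a fin_num.
  by rewrite ge0_fin_numE//; exact: integral_ge0.
have finD n : (\int[P0]_(w in D n) W w)%E \is a fin_num.
  rewrite ge0_fin_numE; last exact: integral_ge0.
  by apply: le_lt_trans finW; exact: ge0_subset_integral.
rewrite (_ : (fun n => _) =
    (fun n => (\int[P0]_w W w) - (\int[P0]_(w in D n) W w))%E).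
  rewrite -[X in _ --> X](subee finI); apply: cvgeB => //.
    by rewrite fin_num_adde_defr.
  exact: cvg_cst.
apply/funext => n; rewrite -[in RHS](setvU [set w | (n <= T w)%N]).
rewrite ge0_integral_setU//.
  by rewrite -/(D n) addeAC (subee (finD n)) add0e.
- exact: (mD n).
- by apply/disj_setPS => w [].
Qed.

(** [M] is the value of optimally stopping [`|f| + `|g| + `|h|], bounded on the
    killed process by the sum [W] of the three integrable suprema. *)
Lemma majorant_exists :
  (forall x, sup_killed_in_L1 (P x) X T f) ->
  (forall x, sup_killed_in_L1 (P x) X T g) ->
  (forall x, sup_killed_in_L1 (P x) X T h) ->
  exists M, majorant Pi P X alpha f g h M.
Proof.
move=> intf intg inth.
pose phi y : \bar R := (`|f y| + `|g y| + `|h y|)%:E.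
pose W w := (sup_killed f w + sup_killed g w + sup_killed h w)%E.
have gphi : ge0_measurable phi.
  split; last by move=> y; rewrite lee_fin !addr_ge0.
  apply/measurable_EFinP; apply: measurable_funD; first apply: measurable_funD;
  exact: measurableT_comp.
have gS u x : sup_killed_in_L1 (P x) X T u -> ge0_measurable (sup_killed u).
  by move=> /integrableP[? _]; split.
have gW (x : E) : ge0_measurable W.
  split; last by move=> w; rewrite !adde_ge0.
  have [mf _] := gS f x (intf x); have [mg _] := gS g x (intg x).
  have [mh _] := gS h x (inth x).
  by apply: emeasurable_funD => //; exact: emeasurable_funD.
have finW x : (\int[P x]_w W w < +oo)%E.
  have fS u : sup_killed_in_L1 (P x) X T u -> (\int[P x]_w sup_killed u w < +oo)%E.
    move=> /integrableP[_]; apply: le_lt_trans; rewrite le_eqVlt; apply/orP; left.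
    by apply/eqP; apply: eq_integral => w _; rewrite gee0_abs//; exact: (sup_killed_ge0 u w).
  have [mf _] := gS f x (intf x); have [mg _] := gS g x (intg x).
  have [mh _] := gS h x (inth x).
  rewrite ge0_integralD//; last 2 first.
  - by move=> w _; rewrite adde_ge0.
  - exact: emeasurable_funD.
  rewrite ge0_integralD//.
  by apply: lte_add_pinfty; [apply: lte_add_pinfty|]; apply: fS.
have phiW m w : (m <= T w)%N -> (phi (X m w) <= W w)%E.
  by move=> mT; rewrite /phi !EFinD; apply: leeD; [apply: leeD|]; exact: sup_killed_ge.
pose S := excessive_majorant Pi alpha phi.
have gM : ge0_measurable S by exact: excessive_majorant_ge0_measurable.
have killed x m := excessive_majorant_killed alpha0 (markovX x)
  (independent_sources3 (indep x)) (independent_survival (indep x) (killT x))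
  gphi (gW x) phiW m.
have finS x : S x \is a fin_num.
  rewrite ge0_fin_numE; last exact: gM.2.
  have := killed x 0%N; rewrite mul1e (integral_initial (markovX x) gM) => /le_lt_trans.
  apply; apply: le_lt_trans (finW x); apply: ge0_subset_integral => //.
  - exact: measurable_survival.
  - exact: (gW x).1.
  - by move=> w _; exact: (gW x).2.
have SE : (fun y => (fine (S y))%:E) = S by apply/funext => y; rewrite fineK.
have le_S y (r : R) : r <= `|f y| + `|g y| + `|h y| -> r <= fine (S y).
  move=> /le_trans; apply; rewrite -lee_fin fineK//.
  exact: (@excessive_majorant_ge _ _ _ Pi _ alpha0 phi gphi y).
have nf y := normr_ge0 (f y); have ng y := normr_ge0 (g y).
have nh y := normr_ge0 (h y).
exists (fine \o S); split => [|y|y|y|y|x].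
- by apply/measurable_EFinP; rewrite [X in measurable_fun _ X]SE; exact: gM.1.
- by apply: le_S; have := nf y; have := ng y; have := nh y; lra.
- by apply: le_S; have := nf y; have := ng y; have := nh y; lra.
- by apply: le_S; have := nf y; have := ng y; have := nh y; lra.
- by rewrite /= SE fineK//; exact: excessive_majorant_excessive.
- apply: (@squeeze_cvge _ _ _ _ (cst 0%E) _
    (fun n => \int[P x]_(w in [set w | (n <= T w)%N]) W w)%E).
  + near=> n; apply/andP; split.
      apply: mule_ge0; first by rewrite lee_fin exprn_ge0.
      by apply: integral_ge0 => w _; rewrite /= fineK//; exact: gM.2.
    apply: le_trans (killed x n); rewrite le_eqVlt; apply/orP; left; apply/eqP.
    by congr (_ * _)%E; apply: eq_integral => w _; rewrite /= fineK.
  + exact: cvg_cst.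
  + exact: integral_survival_cvg0 (gW x) (finW x).
Unshelve. all: by end_near. Qed.

End majorant_exists.

(** * Two-by-two matrix games *)

Section matrix_game.
Context (R : realType).
Implicit Types a b c d v p q : R.

(** Payoffs to the row player, who maximizes: [a] if both stop, [b] if only the row
    player stops, [c] if only the column player stops, [d] if both continue. The
    probability [p] of stopping guarantees [v] against both pure replies. *)
Definition secures_row a b c d p v :=
  [/\ 0 <= p <= 1, v <= p * a + (1 - p) * c & v <= p * b + (1 - p) * d].

Definition secures_col a b c d q v :=
  [/\ 0 <= q <= 1, q * a + (1 - q) * b <= v & q * c + (1 - q) * d <= v].

(** Exchanging the players transposes the matrix and changes signs. *)
Lemma secures_rowN a b c d p v :
  secures_row a b c d p v -> secures_col (- a) (- c) (- b) (- d) p (- v).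
Proof. by case=> p01 H1 H2; split=> //; rewrite !mulrN -opprD lerN2. Qed.

(** Evaluate both matrices at the pair of mixed strategies [(p, q)]: they differ
    only in the entry where both continue. Monotonicity and nonexpansiveness of
    the value in that entry come from this bound. *)
Lemma secures_diff a b c d d' p q v v' :
  secures_row a b c d p v -> secures_col a b c d' q v' ->
  v - v' <= (1 - p) * (1 - q) * (d - d').
Proof.
case=> /andP[p0 p1] H1 H2 [/andP[q0 q1] H3 H4].
have p1' : 0 <= 1 - p by rewrite subr_ge0.
have q1' : 0 <= 1 - q by rewrite subr_ge0.
have := ler_wpM2l q0 H1; have := ler_wpM2l q1' H2.
have := ler_wpM2l p0 H3; have := ler_wpM2l p1' H4.
lra.
Qed.

Lemma secures_le a b c d d' p q v v' :
  secures_row a b c d p v -> secures_col a b c d' q v' -> d <= d' -> v <= v'.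
Proof.
move=> H1 H2 dd'; rewrite -subr_le0; apply: le_trans (secures_diff H1 H2) _.
case: H1 H2 => /andP[p0 p1] _ _ [/andP[q0 q1] _ _].
apply: mulr_ge0_le0; last by rewrite subr_le0.
by rewrite mulr_ge0// subr_ge0.
Qed.

Lemma secures_diff_norm a b c d d' p q v v' :
  secures_row a b c d p v -> secures_col a b c d' q v' -> v - v' <= `|d - d'|.
Proof.
move=> H1 H2; apply: le_trans (secures_diff H1 H2) _.
case: H1 H2 => /andP[p0 p1] _ _ [/andP[q0 q1] _ _].
have s0 : 0 <= (1 - p) * (1 - q) by rewrite mulr_ge0// subr_ge0.
have s1 : (1 - p) * (1 - q) <= 1 by nra.
apply: le_trans (ler_wpM2l s0 (ler_norm _)) _.
by rewrite ler_piMl.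
Qed.

Lemma secures_row_le a b c d p v m : secures_row a b c d p v ->
  `|a| <= m -> `|b| <= m -> `|c| <= m -> `|d| <= m -> v <= m.
Proof.
case=> /andP[p0 p1] H1 _; rewrite !ler_norml.
move=> /andP[_ am] _ /andP[_ cm] _; nra.
Qed.

Lemma secures_col_ge a b c d q v m : secures_col a b c d q v ->
  `|a| <= m -> `|b| <= m -> `|c| <= m -> `|d| <= m -> - m <= v.
Proof.
case=> /andP[q0 q1] H1 _; rewrite !ler_norml.
move=> /andP[am _] /andP[bm _] _ _; nra.
Qed.

Definition lower_value a b c d := Num.max (Num.min a b) (Num.min c d).
Definition upper_value a b c d := Num.min (Num.max a c) (Num.max b d).

(** The saddle value if there is one, and otherwise the value of the completely
    mixed equilibrium, which equalizes the opponent's two replies. Explicit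
    formulas make the value and the strategies measurable in the entries. *)
Definition game_value a b c d :=
  if upper_value a b c d <= lower_value a b c d then lower_value a b c d
  else (a * d - b * c) / (a + d - b - c).

Definition row_strategy a b c d :=
  if upper_value a b c d <= lower_value a b c d then
    if Num.min c d <= Num.min a b then 1 else 0
  else (d - c) / (a + d - b - c).

Definition col_strategy a b c d :=
  if upper_value a b c d <= lower_value a b c d then
    if Num.max a c <= Num.max b d then 1 else 0
  else (d - b) / (a + d - b - c).

(** Without a pure saddle point the two players' preferences cycle, so one
    diagonal strictly dominates the other. *)
Lemma no_saddle a b c d : lower_value a b c d < upper_value a b c d ->
  [/\ b < a, c < a, b < d & c < d] \/ [/\ a < b, a < c, d < b & d < c].
Proof.
rewrite /lower_value /upper_value lt_min !gt_max.
case: (ltgtP a b) => ab; case: (ltgtP c d) => cd; case: (ltgtP a c) => ac;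
  case: (ltgtP b d) => bd /andP[/andP[H1 H2] /andP[H3 H4]];
  solve [by left; split; lra | by right; split; lra | lra].
Qed.

Lemma row_strategy_secures a b c d :
  secures_row a b c d (row_strategy a b c d) (game_value a b c d).
Proof.
rewrite /row_strategy /game_value; case: leP => [_|/no_saddle ns].
  rewrite /lower_value; case: leP => H.
    by split; rewrite ?ler01 ?lexx// subrr mul1r mul0r addr0 ge_min lexx ?orbT.
  by split; rewrite ?ler01 ?lexx// subr0 mul1r mul0r add0r ge_min lexx ?orbT.
have D0 : a + d - b - c != 0.
  by case: ns => -[H1 H2 H3 H4]; [rewrite gt_eqF//|rewrite lt_eqF//]; lra.
split; last 2 first.
- by rewrite le_eqVlt; apply/orP; left; apply/eqP; field.
- by rewrite le_eqVlt; apply/orP; left; apply/eqP; field.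
case: ns => -[H1 H2 H3 H4].
  have D1 : 0 < a + d - b - c by lra.
  by rewrite ler_pdivlMr// ler_pdivrMr// mul0r mul1r; apply/andP; split; lra.
have D1 : a + d - b - c < 0 by lra.
by rewrite ler_ndivlMr// ler_ndivrMr// mul0r mul1r; apply/andP; split; lra.
Qed.

Lemma lower_le_upper a b c d : lower_value a b c d <= upper_value a b c d.
Proof.
rewrite /lower_value /upper_value ge_max !le_min !le_max !ge_min !lexx.
by rewrite !orbT.
Qed.

Lemma col_strategy_secures a b c d :
  secures_col a b c d (col_strategy a b c d) (game_value a b c d).
Proof.
rewrite /col_strategy /game_value; case: leP => [ul|/no_saddle ns].
  have -> : lower_value a b c d = upper_value a b c d.
    by apply/eqP; rewrite eq_le lower_le_upper.
  rewrite /upper_value; case: leP => H.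
    by split; rewrite ?ler01 ?lexx// subrr mul1r mul0r addr0 le_max lexx ?orbT.
  by split; rewrite ?ler01 ?lexx// subr0 mul1r mul0r add0r le_max lexx ?orbT.
have D0 : a + d - b - c != 0.
  by case: ns => -[H1 H2 H3 H4]; [rewrite gt_eqF//|rewrite lt_eqF//]; lra.
split; last 2 first.
- by rewrite le_eqVlt; apply/orP; left; apply/eqP; field.
- by rewrite le_eqVlt; apply/orP; left; apply/eqP; field.
case: ns => -[H1 H2 H3 H4].
  have D1 : 0 < a + d - b - c by lra.
  by rewrite ler_pdivlMr// ler_pdivrMr// mul0r mul1r; apply/andP; split; lra.
have D1 : a + d - b - c < 0 by lra.
by rewrite ler_ndivlMr// ler_ndivrMr// mul0r mul1r; apply/andP; split; lra.
Qed.

(** The two inequalities of the theorem exclude the two cyclic configurations. *)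
Lemma saddle_condition a b c d :
  Num.min b c <= Num.max a d -> Num.min a d <= Num.max b c ->
  upper_value a b c d <= lower_value a b c d.
Proof.
move=> H1 H2; rewrite leNgt; apply/negP => /no_saddle[] [H3 H4 H5 H6].
  by move: H2; rewrite leNgt gt_max !lt_min H3 H4 H5 H6.
by move: H1; rewrite leNgt gt_max !lt_min H3 H4 H5 H6.
Qed.

Lemma saddle_row a b c d p v : secures_row a b c d p v ->
  upper_value a b c d <= lower_value a b c d ->
  (v <= a /\ v <= b) \/ (v <= c /\ v <= d).
Proof.
case=> /andP[p0 p1] H1 H2 ul.
have : v <= lower_value a b c d.
  apply: le_trans ul; rewrite /upper_value le_min; apply/andP; split.
    by case: (leP a c) => ac; nra.
  by case: (leP b d) => ac; nra.
rewrite /lower_value le_max !le_min => /orP[/andP[? ?]|/andP[? ?]]; [left|right];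
  by split.
Qed.

Lemma saddle_col a b c d q v : secures_col a b c d q v ->
  upper_value a b c d <= lower_value a b c d ->
  (a <= v /\ c <= v) \/ (b <= v /\ d <= v).
Proof.
case=> /andP[q0 q1] H1 H2 ul.
have : upper_value a b c d <= v.
  apply: le_trans ul _; rewrite /lower_value ge_max; apply/andP; split.
    by case: (leP a b) => ab; nra.
  by case: (leP c d) => cd; nra.
rewrite /upper_value ge_min !ge_max => /orP[/andP[? ?]|/andP[? ?]]; [left|right];
  by split.
Qed.

(** Conversely, a pure choice of each player that guarantees [v] on its own side
    produces a saddle point, hence both inequalities. *)
Lemma pure_saddle a b c d v :
  (v <= a /\ v <= b) \/ (v <= c /\ v <= d) ->
  (a <= v /\ c <= v) \/ (b <= v /\ d <= v) ->
  Num.min b c <= Num.max a d /\ Num.min a d <= Num.max b c.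
Proof.
move=> H1 H2; rewrite !ge_min !le_max.
case: H1 => -[l1 l2]; case: H2 => -[u1 u2];
  by rewrite ?(le_trans u1 l1) ?(le_trans u1 l2) ?(le_trans u2 l1) ?(le_trans u2 l2) ?orbT.
Qed.

End matrix_game.

(** * Shapley equation *)

Section measurable_game.
Context (R : realType) d (T : measurableType d).
Implicit Types a b c e : T -> R.

(** Division by zero returns zero, and the power function agrees with this. *)
Lemma measurable_funV a : measurable_fun setT a ->
  measurable_fun setT (fun x => (a x)^-1).
Proof.
move=> ma.
(* a^-1 = a * |a|^-2, and real powers are known to be measurable *)
rewrite (_ : (fun _ => _) = (fun x => a x * (`|a x| `^ (-1)) ^+ 2)); last first.
  apply/funext => x; rewrite powR_inv1//.
  rewrite exprVn real_normK ?num_real//.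
  by have [->|a0] := eqVneq (a x) 0; rewrite ?invr0 ?mul0r//; field.
apply: measurable_funM => //; apply: measurable_funX.
apply: (measurableT_comp (measurable_powR _)); exact: measurableT_comp.
Qed.

Lemma measurable_saddle a b c e : measurable_fun setT a -> measurable_fun setT b ->
  measurable_fun setT c -> measurable_fun setT e ->
  measurable_fun setT (fun x => lower_value (a x) (b x) (c x) (e x)) /\
  measurable_fun setT (fun x => upper_value (a x) (b x) (c x) (e x)).
Proof.
move=> ma mb mc me; split.
  by apply: measurable_maxr; exact: measurable_minr.
by apply: measurable_minr; exact: measurable_maxr.
Qed.

Lemma measurable_game_value a b c e : measurable_fun setT a -> measurable_fun setT b ->
  measurable_fun setT c -> measurable_fun setT e ->
  measurable_fun setT (fun x => game_value (a x) (b x) (c x) (e x)).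
Proof.
move=> ma mb mc me; have [ml mu] := measurable_saddle ma mb mc me.
apply: measurable_fun_ifT => //; first exact: measurable_fun_ler.
apply: measurable_funM; first by apply: measurable_funB; exact: measurable_funM.
apply: measurable_funV; apply: measurable_funB => //; apply: measurable_funB => //.
exact: measurable_funD.
Qed.

Lemma measurable_row_strategy a b c e : measurable_fun setT a -> measurable_fun setT b ->
  measurable_fun setT c -> measurable_fun setT e ->
  measurable_fun setT (fun x => row_strategy (a x) (b x) (c x) (e x)).
Proof.
move=> ma mb mc me; have [ml mu] := measurable_saddle ma mb mc me.
apply: measurable_fun_ifT => //; first exact: measurable_fun_ler.
  apply: measurable_fun_ifT => //.
  by apply: measurable_fun_ler; exact: measurable_minr.
apply: measurable_funM; first exact: measurable_funB.
apply: measurable_funV; apply: measurable_funB => //; apply: measurable_funB => //.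
exact: measurable_funD.
Qed.

Lemma measurable_col_strategy a b c e : measurable_fun setT a -> measurable_fun setT b ->
  measurable_fun setT c -> measurable_fun setT e ->
  measurable_fun setT (fun x => col_strategy (a x) (b x) (c x) (e x)).
Proof.
move=> ma mb mc me; have [ml mu] := measurable_saddle ma mb mc me.
apply: measurable_fun_ifT => //; first exact: measurable_fun_ler.
  apply: measurable_fun_ifT => //.
  by apply: measurable_fun_ler; exact: measurable_maxr.
apply: measurable_funM; first exact: measurable_funB.
apply: measurable_funV; apply: measurable_funB => //; apply: measurable_funB => //.
exact: measurable_funD.
Qed.

End measurable_game.

Section shapley.
Context (R : realType) d' (E : measurableType d').
Variables (Pi : R.-pker E ~> E) (alpha : R) (M : E -> R).
Hypothesis alpha0 : 0 < alpha.
Hypothesis mM : measurable_fun setT M.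
Hypothesis M0 : forall y, 0 <= M y.
Hypothesis excM : forall y, (alpha%:E * \int[Pi y]_z (M z)%:E <= (M y)%:E)%E.

Definition dominated (u : E -> R) := measurable_fun setT u /\ forall y, `|u y| <= M y.

Lemma dominated_majorant : dominated M.
Proof. by split=> // y; rewrite ger0_norm. Qed.

Lemma dominated_integrable u y : dominated u -> (Pi y).-integrable setT (EFin \o u).
Proof.
move=> [mu uM]; apply: (@le_integrable _ _ _ _ _ measurableT _ (EFin \o M)).
- exact/measurable_EFinP.
- by move=> z _ /=; rewrite lee_fin (ger0_norm (M0 z)).
- apply/integrableP; split; first exact/measurable_EFinP.
  under eq_integral => z _ do rewrite /= ger0_norm//.
  rewrite ltey; apply/negP => /eqP I.
  by have := excM y; rewrite I gt0_muley ?lte_fin// leye_eq.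
Qed.

Lemma kernel_opE u y : dominated u -> (\int[Pi y]_z (u z)%:E)%E = (kernel_op Pi u y)%:E.
Proof.
move=> du; rewrite fineK//.
by apply: integrable_fin_num => //; exact: dominated_integrable.
Qed.

Lemma kernel_op_le u v y : dominated u -> dominated v -> (forall z, u z <= v z) ->
  kernel_op Pi u y <= kernel_op Pi v y.
Proof. by move=> du dv uv; apply: le_Rintegral => //; exact: dominated_integrable. Qed.

Lemma measurable_kernel_op u : dominated u -> measurable_fun setT (kernel_op Pi u).
Proof.
move=> du.
have nonneg (v : E -> R) : measurable_fun setT v -> (forall y, 0 <= v y) ->
    measurable_fun setT (kernel_op Pi v).
  move=> mv v0.
  have [mk _] : ge0_measurable (fun y => \int[Pi y]_z (v z)%:E)%E.
    apply: ge0_measurable_kernel; split; last by move=> z; rewrite lee_fin.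
    exact/measurable_EFinP.
  have mf : measurable_fun (@setT (\bar R)) (@fine R) by exact: fine_measurable.
  exact: (measurableT_comp mf mk).
have -> : kernel_op Pi u = kernel_op Pi (u \+ M) \- kernel_op Pi M.
  apply/funext => y /=; rewrite /kernel_op RintegralD//; first by rewrite addrK.
    exact: dominated_integrable.
  exact: dominated_integrable dominated_majorant.
apply: measurable_funB; last exact: nonneg.
apply: nonneg => [|y /=]; first by apply: measurable_funD => //; exact: du.1.
by have := du.2 y; rewrite ler_norml => /andP[+ _]; lra.
Qed.

Lemma dominated_continuation u : dominated u ->
  dominated (fun y => alpha * kernel_op Pi u y).
Proof.
move=> du; split.
  by apply: measurable_funM => //; exact: measurable_kernel_op.
move=> y; have le1 : alpha * kernel_op Pi M y <= M y.
  by have := excM y; rewrite (kernel_opE y dominated_majorant).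
rewrite normrM gtr0_norm//; apply: le_trans le1; rewrite ler_pM2l//.
apply: le_trans (le_normr_Rintegral _ _) _ => //; first exact: dominated_integrable.
apply: le_Rintegral => //.
- by apply: (@integrable_abse _ _ _ _ _ (EFin \o u)) => //; exact: dominated_integrable.
- exact: dominated_integrable dominated_majorant.
- by move=> z _; exact: du.2.
Qed.

Variables f g h : E -> R.
Hypotheses (df : dominated f) (dg : dominated g) (dh : dominated h).

Definition shapley u y := game_value (h y) (f y) (g y) (alpha * kernel_op Pi u y).

Lemma dominated_shapley u : dominated u -> dominated (shapley u).
Proof.
move=> du; have dc := dominated_continuation du; split.
  by apply: measurable_game_value; [exact: dh.1|exact: df.1|exact: dg.1|exact: dc.1].
move=> y; rewrite ler_norml; apply/andP; split.
  by apply: (secures_col_ge (col_strategy_secures _ _ _ _));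
    [exact: dh.2|exact: df.2|exact: dg.2|exact: dc.2].
by apply: (secures_row_le (row_strategy_secures _ _ _ _));
  [exact: dh.2|exact: df.2|exact: dg.2|exact: dc.2].
Qed.

(** Starting from [- M], a subsolution, the iterates increase and stay in
    [[- M, M]]. The continuation payoffs converge by domination by [M], and the
    value of the matrix game is nonexpansive in them, so the limit is fixed. *)
Lemma shapley_fixpoint : exists2 u, dominated u & forall y, u y = shapley u y.
Proof.
pose u n := iter n shapley (fun y => - M y).
have du n : dominated (u n).
  elim: n => [|n IH]; last exact: dominated_shapley.
  split; first exact: measurable_funN.
  by move=> y; rewrite /u /= normrN ger0_norm.
have nd1 n y : u n y <= u n.+1 y.
  elim: n y => [|n IH] y.
    by have := (du 1%N).2 y; rewrite ler_norml => /andP[].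
  apply: secures_le (row_strategy_secures _ _ _ _) (col_strategy_secures _ _ _ _) _.
  by rewrite ler_pM2l//; exact: (kernel_op_le y (du n) (du n.+1) IH).
have nd y : nondecreasing_seq (u ^~ y) by apply/nondecreasing_seqP => n; exact: nd1.
have cu y : cvgn (u ^~ y).
  apply: nondecreasing_is_cvgn => //; exists (M y) => _ [n _ <-].
  by have := (du n).2 y; rewrite ler_norml => /andP[].
pose v y := limn (u ^~ y).
have cuv y : (u ^~ y) @ \oo --> v y by exact: cu.
have dv : dominated v.
  split; first by apply: measurable_fun_cvg (fun n => (du n).1) _ => y _.
  move=> y; rewrite ler_norml; apply/andP; split.
    by apply: limr_ge => //; near=> n; have := (du n).2 y; rewrite ler_norml => /andP[].
  by apply: limr_le => //; near=> n; have := (du n).2 y; rewrite ler_norml => /andP[].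
exists v => // y.
have ck : (fun n => kernel_op Pi (u n) y) @ \oo --> kernel_op Pi v y.
  have [_ _ c] : [/\ (Pi y).-integrable setT (EFin \o v),
     (\int[Pi y]_z `|(u n z)%:E - (v z)%:E|)%E @[n --> \oo] --> 0%E &
     (\int[Pi y]_z (u n z)%:E)%E @[n --> \oo] --> (\int[Pi y]_z (v z)%:E)%E].
    apply: (@dominated_convergence _ _ _ _ _ measurableT
      (fun n => EFin \o u n) (EFin \o v) (EFin \o M)).
    - by move=> n; apply/measurable_EFinP; exact: (du n).1.
    - by apply/measurable_EFinP; exact: dv.1.
    - by apply: aeW => z _; apply: cvg_EFin; [near=> n|exact: cuv].
    - exact: dominated_integrable dominated_majorant.
    - by apply: aeW => z n _; rewrite /= lee_fin; exact: (du n).2.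
  move: c; rewrite kernel_opE//.
  under eq_fun do rewrite kernel_opE//.
  by move/fine_cvgP => [].
have c0 : (fun n => `|alpha * kernel_op Pi (u n) y - alpha * kernel_op Pi v y|) @ \oo --> 0.
  rewrite -(normr0 R) -(subrr (alpha * kernel_op Pi v y)).
  by apply: cvg_norm; apply: cvgB; [apply: cvgMr|exact: cvg_cst].
have cS : (fun n => u n.+1 y) @ \oo --> shapley v y.
  pose e n := `|alpha * kernel_op Pi (u n) y - alpha * kernel_op Pi v y|.
  apply: (@squeeze_cvgr _ _ _ _ (fun n => shapley v y - e n) (fun n => shapley v y + e n)).
  - near=> n; apply/andP; split.
      rewrite lerBlDr -lerBlDl /e distrC.
      exact: secures_diff_norm (row_strategy_secures _ _ _ _) (col_strategy_secures _ _ _ _).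
    rewrite -lerBlDl.
    exact: secures_diff_norm (row_strategy_secures _ _ _ _) (col_strategy_secures _ _ _ _).
  - by rewrite -[X in _ --> X]subr0; apply: cvgB => //; exact: cvg_cst.
  - by rewrite -[X in _ --> X]addr0; apply: cvgD => //; exact: cvg_cst.
have c1 : (fun n => u n.+1 y) @ \oo --> v y by rewrite (cvg_shiftS (u ^~ y)).
exact: cvg_unique c1 cS.
Unshelve. all: by end_near. Qed.

End shapley.

(** * Conditioning with signed functions *)

Section real_steps.
Context d (Omega : measurableType d) (R : realType) (P : probability Omega R).
Context d' (E : measurableType d') (Pi : R.-pker E ~> E) (alpha : R) (M : E -> R).
Variables (X : nat -> {mfun Omega >-> E}) (eta xi : nat -> {mfun Omega >-> R}).
Variable x : E.
Hypothesis alpha0 : 0 < alpha.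
Hypothesis mM : measurable_fun setT M.
Hypothesis M0 : forall y, 0 <= M y.
Hypothesis excM : forall y, (alpha%:E * \int[Pi y]_z (M z)%:E <= (M y)%:E)%E.
Hypothesis markov : is_markov_process P Pi X x.
Hypothesis iid : is_iid_uniform P xi.
Hypothesis ind : forall A B C, sigma_process X A -> sigma_process eta B ->
  sigma_process xi C -> P (A `&` B `&` C) = (P A * P B * P C)%E.

Let gM : ge0_measurable (EFin \o M).
Proof. by split; [exact/measurable_EFinP|move=> y; rewrite lee_fin]. Qed.

Lemma majorant_state_integrable n : (\int[P]_w (M (X n w))%:E < +oo)%E.
Proof.
elim: n => [|n IH].
  by rewrite (integral_initial markov gM) ltry.
rewrite ltey; apply/negP => /eqP I; move: IH.
have II : (\int[P]_w \int[Pi (X n w)]_y (M y)%:E = +oo)%E.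
  by rewrite -I; apply/esym; exact: (markov_step markov ind n gM).
have mk := (ge0_measurable_kernel Pi gM).
have mX : measurable_fun setT (X n) by [].
have : (\int[P]_w (alpha%:E * \int[Pi (X n w)]_y (M y)%:E) <= \int[P]_w (M (X n w))%:E)%E.
  apply: ge0_le_integral => //.
  - by move=> w _; apply: mule_ge0; [rewrite lee_fin ltW|exact: mk.2].
  - by apply: measurable_funeM; exact: measurableT_comp mk.1 mX.
  - exact: measurableT_comp gM.1 mX.
rewrite ge0_integralZl_EFin//; last 3 first.
- by move=> w _; exact: mk.2.
- exact: measurableT_comp mk.1 mX.
- exact: ltW.
by rewrite II gt0_muley ?lte_fin// leye_eq => /eqP ->.
Qed.

Lemma dominated_state_integrable n A u : dominated M u -> measurable A ->
  P.-integrable A (EFin \o (u \o X n)).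
Proof.
move=> [mu uM] mA; have mX : measurable_fun setT (X n) by [].
apply: (@integrableS _ _ _ _ setT) => //.
apply: (@le_integrable _ _ _ _ _ measurableT _ (EFin \o (M \o X n))).
- by apply/measurable_EFinP; exact: measurableT_comp mu mX.
- by move=> w _ /=; rewrite lee_fin (ger0_norm (M0 _)).
- apply/integrableP; split.
    by apply/measurable_EFinP; exact: measurableT_comp mM mX.
  under eq_integral => z _ do rewrite /= ger0_norm//.
  exact: majorant_state_integrable.
Qed.

(** Reduces the identities for signed functions to the nonnegative case. *)
Lemma dominated_split u : dominated M u -> exists v1 v2,
  [/\ dominated M v1, dominated M v2, forall y, 0 <= v1 y, forall y, 0 <= v2 y
   & u = v1 \- v2].
Proof.
move=> [mu uM]; exists (fun y => Num.max (u y) 0), (fun y => Num.max (- u y) 0).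
split.
- split; first exact: measurable_maxr.
  move=> y; have := uM y; rewrite !ler_norml => /andP[h1 h2].
  have h4 := M0 y; case: (leP _ 0) => h3; by apply/andP; split; lra.
- split; first by apply: measurable_maxr => //; exact: measurable_funN.
  move=> y; have := uM y; rewrite !ler_norml => /andP[h1 h2].
  have h4 := M0 y; case: (leP _ 0) => h3; by apply/andP; split; lra.
- by move=> y; rewrite le_max lexx orbT.
- by move=> y; rewrite le_max lexx orbT.
- by apply/funext => y /=; case: leP => h1; case: leP => h2; lra.
Qed.

Lemma dominated_mul u (q : E -> R) : dominated M u -> measurable_fun setT q ->
  (forall y, 0 <= q y <= 1) -> dominated M (fun y => q y * u y).
Proof.
move=> [mu uM] mq q01; split; first exact: measurable_funM.
move=> y; have /andP[q0 q1] := q01 y.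
rewrite normrM ger0_norm//; apply: le_trans (uM y).
by rewrite ler_piMl.
Qed.

Lemma kernel_op_dominated_integrable n A u : dominated M u -> measurable A ->
  P.-integrable A (EFin \o (kernel_op Pi u \o X n)).
Proof.
move=> du mA.
have := dominated_state_integrable n
  (dominated_continuation alpha0 mM M0 excM du) mA.
move=> /(integrableZl mA alpha^-1).
congr (integrable _ _ _); apply/funext => w /=.
by rewrite -EFinM mulrA mulVf ?mul1r// gt_eqF.
Qed.

Lemma markov_Rintegral n m A u : history X eta xi n m A -> dominated M u ->
  \int[P]_(w in A) u (X n.+1 w) = \int[P]_(w in A) kernel_op Pi u (X n w).
Proof.
move=> hA /dominated_split[v1 [v2 [dv1 dv2 v10 v20 ->]]].
have mA := history_measurable hA.
have nonneg (v : E -> R) : dominated M v -> (forall y, 0 <= v y) ->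
    \int[P]_(w in A) v (X n.+1 w) = \int[P]_(w in A) kernel_op Pi v (X n w).
  move=> dv v0; rewrite /Rintegral; congr fine.
  have gv : ge0_measurable (EFin \o v).
    by split; [apply/measurable_EFinP; exact: dv.1|move=> y; rewrite lee_fin].
  rewrite (markov_history markov ind hA gv); apply: eq_integral => w _.
  by rewrite (kernel_opE alpha0 mM M0 excM).
rewrite RintegralB//; try exact: dominated_state_integrable.
rewrite !nonneg// -RintegralB//; try exact: kernel_op_dominated_integrable.
apply: eq_Rintegral => w _; rewrite /kernel_op RintegralB//;
  exact: (dominated_integrable alpha0 mM M0 excM).
Qed.

Lemma randomization_Rintegral n A (q : E -> R) u : history X eta xi n n A ->
  measurable_fun setT q -> (forall y, 0 <= q y <= 1) -> dominated M u ->
  \int[P]_(w in A `&` [set w | xi n w <= q (X n w)]) u (X n w) =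
  \int[P]_(w in A) (q (X n w) * u (X n w)).
Proof.
move=> hA mq q01 /dominated_split[v1 [v2 [dv1 dv2 v10 v20 ->]]].
have mA := history_measurable hA.
have mX : measurable_fun setT (X n) by [].
have mD : measurable [set w | xi n w <= q (X n w)].
  have mxi : measurable_fun setT (xi n) by [].
  have := measurable_fun_ler mxi (measurableT_comp mq mX) measurableT.
  by move=> /(_ [set true] I); rewrite setTI; congr measurable; apply/seteqP; split.
have mAD := measurableI _ _ mA mD.
have nonneg (v : E -> R) : dominated M v -> (forall y, 0 <= v y) ->
    \int[P]_(w in A `&` [set w | xi n w <= q (X n w)]) v (X n w) =
    \int[P]_(w in A) (q (X n w) * v (X n w)).
  move=> dv v0; rewrite /Rintegral; congr fine.
  have gv : ge0_measurable (EFin \o v).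
    by split; [apply/measurable_EFinP; exact: dv.1|move=> y; rewrite lee_fin].
  rewrite (integral_randomization iid ind hA mq q01 gv); apply: eq_integral => w _.
  by rewrite EFinM.
rewrite RintegralB//; try exact: dominated_state_integrable.
have dq v : dominated M v -> P.-integrable A (EFin \o (fun w => q (X n w) * v (X n w))).
  move=> dv; exact: dominated_state_integrable (dominated_mul dv mq q01) mA.
rewrite !nonneg// -RintegralB//; try exact: dq.
by apply: eq_Rintegral => w _; rewrite mulrBr.
Qed.

End real_steps.

(** * Stopping times and payoffs *)

Definition running (t : option nat) (n : nat) : bool :=
  if t is Some k then (n <= k)%N else true.

Lemma running_le t m n : (m <= n)%N -> running t n -> running t m.
Proof. by case: t => //= k; exact: leq_trans. Qed.

Section randomized_time.
Context d (Omega : measurableType d) (R : realType) d' (E : measurableType d').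
Variables (X : nat -> {mfun Omega >-> E}) (xi : nat -> {mfun Omega >-> R}).

(** The stopping probabilities may depend on time, so that a player can be made to
    skip the first stage; for constant [p] this is the Markovian time. *)
Definition randomized_time (p : nat -> E -> R) (w : Omega) : option nat :=
  match pselect (exists n, xi n w <= p n (X n w)) with
  | left ex => Some (ex_minn ex)
  | right _ => None
  end.

Lemma running_randomized_time p w n :
  running (randomized_time p w) n <-> forall k, (k < n)%N -> ~~ (xi k w <= p k (X k w)).
Proof.
rewrite /randomized_time; case: pselect => [ex|nex] /=.
  case: ex_minnP => m hit min; split=> [nm k kn|H].
    by apply: contraL kn => /min mk; rewrite -leqNgt; exact: leq_trans mk.
  by rewrite leqNgt; apply/negP => /H; rewrite hit.
by split=> // _ k _; apply/negP => H; apply: nex; exists k.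
Qed.

Lemma running_randomized_timeS p w n : running (randomized_time p w) n.+1 =
  running (randomized_time p w) n && ~~ (xi n w <= p n (X n w)).
Proof.
apply/idP/andP => [/running_randomized_time H|[/running_randomized_time H nhit]].
  by split; [apply/running_randomized_time => k kn|]; apply: H => //; exact: ltnW.
apply/running_randomized_time => k; rewrite ltnS leq_eqVlt => /predU1P[->//|].
exact: H.
Qed.

End randomized_time.

Section payoff.
Context d (Omega : measurableType d) (R : realType) d' (E : measurableType d').
Variables (X : nat -> {mfun Omega >-> E}) (alpha : R) (f g h : E -> R).
Hypotheses (mf : measurable_fun setT f) (mg : measurable_fun setT g)
  (mh : measurable_fun setT h).
Variables (s t : Omega -> option nat).

Definition alive (n : nat) : set Omega := [set w | running (s w) n && running (t w) n].

Definition stage_payoff (n : nat) (w : Omega) : R :=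
  alpha ^+ n * (if running (s w) n.+1 then g (X n w)
                else if running (t w) n.+1 then f (X n w) else h (X n w)).

Lemma payoff_stage n w : alive n w -> ~ alive n.+1 w ->
  payoff X alpha f g h s t w = stage_payoff n w.
Proof.
rewrite /alive/= /payoff /stage_payoff => /andP[].
case: (s w) => [j|] /=; case: (t w) => [k|] //=.
- move=> nj nk; have [nj'|jn] := ltnP n j; have [nk'|kn] := ltnP n k => // _.
  + have -> : k = n by apply/eqP; rewrite eqn_leq kn nk.
    by rewrite ltnNge (ltnW nj')/= nj'.
  + have -> : j = n by apply/eqP; rewrite eqn_leq jn nj.
    by rewrite nk'.
  + have -> : j = n by apply/eqP; rewrite eqn_leq jn nj.
    have -> : k = n by apply/eqP; rewrite eqn_leq kn nk.
    by rewrite ltnn.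
- move=> nj _; have [//|jn] := ltnP n j => _.
  by have -> : j = n by apply/eqP; rewrite eqn_leq jn nj.
- move=> _ nk; have [//|kn] := ltnP n k => _.
  by have -> : k = n by apply/eqP; rewrite eqn_leq kn nk.
Qed.

Lemma payoff_forever w : (forall n, alive n w) -> payoff X alpha f g h s t w = 0.
Proof.
rewrite /alive/= /payoff => H.
case sw: (s w) => [j|]; first by have := H j.+1; rewrite sw/= ltnn.
by case tw: (t w) => [k|] //; have := H k.+1; rewrite tw/= ltnn andbF.
Qed.

Hypothesis ms : forall n, measurable [set w | running (s w) n].
Hypothesis mt : forall n, measurable [set w | running (t w) n].

Lemma measurable_alive n : measurable (alive n).
Proof.
rewrite (_ : alive n = [set w | running (s w) n] `&` [set w | running (t w) n]).
  exact: measurableI.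
by apply/seteqP; split=> w /andP.
Qed.

Lemma alive_nonincr m n : (m <= n)%N -> alive n `<=` alive m.
Proof. by move=> mn w /andP[/(running_le mn) sn /(running_le mn) tn]; apply/andP. Qed.

Lemma measurable_payoff : measurable_fun setT (payoff X alpha f g h s t).
Proof.
(* cut the space by the stage at which the game ends; never is the piece 0 *)
pose F k := if k is n.+1 then alive n `\` alive n.+1 else \bigcap_n alive n.
have mF k : measurable (F k).
  case: k => [|n]; first by apply: bigcap_measurableType => n _; exact: measurable_alive.
  by apply: measurableD; exact: measurable_alive.
have -> : [set: Omega] = \bigcup_k F k.
  apply/seteqP; split=> // w _.
  have [all|] := pselect (forall n, alive n w); first by exists 0%N => // n _.
  move=> /existsNP ex; have {}ex : exists n, ~~ `[< alive n w >].
    by case: ex => n H; exists n; apply/asboolPn.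
  case: (ex_minnP ex) => -[|n] /asboolPn nal min.
    by exfalso; apply: nal; apply/andP; split; [case: (s w)|case: (t w)].
  exists n.+1 => //=; split=> //; apply: contrapT => na.
  by have := min n (introT (asboolPn _) na); rewrite ltnn.
apply/measurable_fun_bigcup => // -[|n].
  apply: (eq_measurable_fun (cst 0 : Omega -> R)); last exact: measurable_cst.
  by move=> w; rewrite inE => al; rewrite payoff_forever// => k; exact: al.
apply: (eq_measurable_fun (stage_payoff n)).
  by move=> w; rewrite inE => -[al nal]; rewrite (payoff_stage al nal).
apply: measurable_funTS.
have mX : measurable_fun setT (X n) by [].
apply: measurable_funM => //; apply: measurable_fun_ifT.
- by apply: (measurable_fun_bool true); rewrite setTI; exact: ms.
- exact: measurableT_comp mg mX.
apply: measurable_fun_ifT.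
- by apply: (measurable_fun_bool true); rewrite setTI; exact: mt.
- exact: measurableT_comp mf mX.
- exact: measurableT_comp mh mX.
Qed.

End payoff.

(** * Verification *)

Section verification.
Context d (Omega : measurableType d) (R : realType) (P : probability Omega R).
Context d' (E : measurableType d') (Pi : R.-pker E ~> E) (alpha : R) (M : E -> R).
Variables (X : nat -> {mfun Omega >-> E}) (eta xi : nat -> {mfun Omega >-> R}).
Variable x : E.
Hypothesis alpha0 : 0 < alpha.
Hypothesis mM : measurable_fun setT M.
Hypothesis M0 : forall y, 0 <= M y.
Hypothesis excM : forall y, (alpha%:E * \int[Pi y]_z (M z)%:E <= (M y)%:E)%E.
Hypothesis vanM :
  ((alpha ^+ n)%:E * \int[P]_w (M (X n w))%:E)%E @[n --> \oo] --> 0%E.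
Hypothesis markov : is_markov_process P Pi X x.
Hypothesis iid : is_iid_uniform P xi.
Hypothesis ind : forall A B C, sigma_process X A -> sigma_process eta B ->
  sigma_process xi C -> P (A `&` B `&` C) = (P A * P B * P C)%E.
Variables f g h : E -> R.
Hypotheses (df : dominated M f) (dg : dominated M g) (dh : dominated M h).
Variables (s : Omega -> option nat) (p : nat -> E -> R).
Hypothesis stop_s : is_stopping_time (joint_filtration X eta) s.
Hypothesis mp : forall n, measurable_fun setT (p n).
Hypothesis p01 : forall n y, 0 <= p n y <= 1.

Let t := randomized_time X xi p.
Let pay := payoff X alpha f g h s t.
Let A := alive s t.

Lemma running_opponent n : joint_filtration X eta n [set w | running (s w) n.+1].
Proof.
rewrite (_ : [set _ | _] = ~` [set w | exists2 k, (k <= n)%N & s w = Some k]).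
  exact: (sigma_algebraC (@stop_s n)).
apply/seteqP; split=> w /=.
  by move=> run [k kn sk]; move: run; rewrite sk /= ltnNge kn.
case: (s w) => //= k H; rewrite ltnNge; apply/negP => kn; apply: H; by exists k.
Qed.

Lemma hit_history n m k : (k <= n)%N -> (k < m)%N ->
  history X eta xi n m [set w | xi k w <= p k (X k w)].
Proof.
move=> kn km; apply: generated_le => B mB; first exact: history_noise.
apply: (@history_state _ _ _ _ _ X eta xi n m k (p k @^-1` B)) => //.
by rewrite -[X in measurable X]setTI; exact: mp.
Qed.

Lemma running_own n m k : (k <= n.+1)%N -> (k <= m)%N ->
  history X eta xi n m [set w | running (t w) k].
Proof.
elim: k => [|k IH] kn km.
  rewrite (_ : [set _ | _] = setT); first exact: setT_generated.
  by apply/seteqP; split=> // w _ /=; case: (t w).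
rewrite (_ : [set _ | _] = [set w | running (t w) k] `&`
    ~` [set w | xi k w <= p k (X k w)]).
  apply: generated_setI; first by apply: IH; exact: ltnW.
  by apply: sigma_algebraC; exact: hit_history.
apply/seteqP; split=> w /=; rewrite /t running_randomized_timeS.
  by move=> /andP[-> /negP].
by move=> [-> /negP].
Qed.

Lemma alive_history n : history X eta xi n n (A n).
Proof.
rewrite (_ : A n = [set w | running (s w) n] `&` [set w | running (t w) n]).
  apply: generated_setI; last exact: running_own.
  case: n => [|n].
    rewrite (_ : [set _ | _] = setT); first exact: setT_generated.
    by apply/seteqP; split=> // w _ /=; case: (s w).
  apply: (@history_mono _ _ _ _ _ X eta xi n n.+1) => //.
  exact: history_opponent (@running_opponent n).
by apply/seteqP; split=> w /andP.
Qed.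

Lemma measurable_running_opponent n : measurable [set w | running (s w) n].
Proof.
case: n => [|n].
  rewrite (_ : [set _ | _] = setT)//.
  by apply/seteqP; split=> // w _ /=; case: (s w).
exact: (history_measurable (history_opponent (xi := xi) (m := 0) (@running_opponent n))).
Qed.

Lemma measurable_running_own n : measurable [set w | running (t w) n].
Proof. by apply: (@history_measurable _ _ _ _ _ X eta xi n n); exact: running_own. Qed.

Let mA n : measurable (A n). Proof. exact: history_measurable (@alive_history n). Qed.

Let mpay : measurable_fun setT pay.
Proof.
apply: measurable_payoff; [exact: df.1|exact: dg.1|exact: dh.1| |].
- exact: measurable_running_opponent.
- exact: measurable_running_own.
Qed.

Let alive_history_next n : history X eta xi n n.+1 (A n.+1).
Proof.
rewrite (_ : A n.+1 = [set w | running (s w) n.+1] `&` [set w | running (t w) n.+1]).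
  apply: generated_setI; last exact: running_own.
  exact: history_opponent (@running_opponent n).
by apply/seteqP; split=> w /andP.
Qed.

Let gM : ge0_measurable (EFin \o M).
Proof. by split; [exact/measurable_EFinP|move=> y; rewrite lee_fin]. Qed.

Let mass n (B : set Omega) := ((alpha ^+ n)%:E * \int[P]_(w in B) (M (X n w))%:E)%E.

Let mass_ge0 n B : (0 <= mass n B)%E.
Proof.
apply: mule_ge0; first by rewrite lee_fin exprn_ge0// ltW.
by apply: integral_ge0 => w _; rewrite lee_fin.
Qed.

Let mMX n (B : set Omega) : measurable_fun B (fun w => (M (X n w))%:E).
Proof.
have mX : measurable_fun setT (X n) by [].
by apply: measurable_funS (measurableT_comp gM.1 mX).
Qed.

Lemma stage_payoff_le n w :
  `|stage_payoff X alpha f g h s t n w| <= alpha ^+ n * M (X n w).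
Proof.
rewrite /stage_payoff normrM ger0_norm; last by rewrite exprn_ge0// ltW.
rewrite ler_pM2l ?exprn_gt0//.
by case: ifP => _; [exact: dg.2|case: ifP => _; [exact: df.2|exact: dh.2]].
Qed.

(** Excessivity pays for the rewards: what stage [n] pays out is at most the mass
    lost between [n] and [n.+1]. *)
Lemma payoff_mass_step n :
  (\int[P]_(w in A n `\` A n.+1) `|pay w|%:E + mass n.+1 (A n.+1) <= mass n (A n))%E.
Proof.
have mD : measurable (A n `\` A n.+1) by exact: measurableD.
have mabs B : measurable_fun B (fun w => `|pay w|%:E).
  by apply: measurable_funTS; apply/measurable_EFinP; exact: measurableT_comp.
have AE : A n = (A n `\` A n.+1) `|` A n.+1.
  rewrite setDE setUIl setUCl setIT setUidl//.
  exact: alive_nonincr.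
rewrite {2}/mass {2}AE ge0_integral_setU//;
  [|by move=> w _; rewrite lee_fin|by apply/disj_setPS => w [[]]].
rewrite ge0_muleDr; [|by apply: integral_ge0 => w _; rewrite lee_fin..].
apply: leeD.
  rewrite -ge0_integralZl_EFin//; [|by move=> w _; rewrite lee_fin|
    by rewrite exprn_ge0// ltW].
  apply: ge0_le_integral => //.
  - by apply: measurable_funeM.
  - move=> w [al nal]; rewrite -EFinM lee_fin /pay (payoff_stage _ _ _ _ _ al nal).
    exact: stage_payoff_le.
rewrite /mass (markov_history markov ind (@alive_history_next n) gM).
rewrite exprSr EFinM -muleA; apply: lee_wpmul2l.
  by rewrite lee_fin exprn_ge0// ltW.
have mk := ge0_measurable_kernel Pi gM.
have mX : measurable_fun setT (X n) by [].
have mkX B : measurable_fun B (fun w => \int[Pi (X n w)]_y (M y)%:E)%E.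
  by apply: measurable_funTS; exact: measurableT_comp mk.1 mX.
rewrite -ge0_integralZl_EFin//; [|by move=> w _; exact: mk.2|exact: ltW].
apply: ge0_le_integral => //.
- by move=> w _; apply: mule_ge0; [rewrite lee_fin ltW|exact: mk.2].
- exact: measurable_funeM.
Qed.

Lemma payoff_mass_upto n k :
  (\int[P]_(w in A n `\` A (n + k)) `|pay w|%:E + mass (n + k) (A (n + k)) <= mass n (A n))%E.
Proof.
have mabs B : measurable_fun B (fun w => `|pay w|%:E).
  by apply: measurable_funTS; apply/measurable_EFinP; exact: measurableT_comp.
elim: k => [|k IH]; first by rewrite addn0 setDv integral_set0 add0e.
apply: le_trans IH; rewrite addnS.
have -> : A n `\` A (n + k).+1 = (A n `\` A (n + k)) `|` (A (n + k) `\` A (n + k).+1).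
  apply/seteqP; split=> w.
    by move=> [al nal]; have [al'|nal'] := pselect (A (n + k)%N w); [right|left].
  move=> [[al nal]|[al nal]]; split=> //.
    by apply: contra_not nal; apply: alive_nonincr.
  by apply: alive_nonincr al; rewrite leq_addr.
rewrite ge0_integral_setU//; [|exact: measurableD|exact: measurableD|
  by apply/disj_setPS => w [[? ?] []]].
by rewrite -addeA leeD2l// payoff_mass_step.
Qed.

(** The mass of the excessive function bounds all payoffs still to come. The
    inequality telescopes over finitely many stages, and outcomes where nobody
    ever stops pay zero. *)
Lemma payoff_mass n : (\int[P]_(w in A n) `|pay w|%:E <= mass n (A n))%E.
Proof.
have mabs B : measurable_fun B (fun w => `|pay w|%:E).
  by apply: measurable_funTS; apply/measurable_EFinP; exact: measurableT_comp.
pose F k := A n `\` A (n + k).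
have mF k : measurable (F k) by exact: measurableD.
have UF : (\int[P]_(w in A n) `|pay w|%:E = \int[P]_(w in \bigcup_k F k) `|pay w|%:E)%E.
  rewrite integral_mkcond [RHS]integral_mkcond; apply: eq_integral => w _.
  rewrite !patchE; case: ifPn => [|/negP nAn]; case: ifPn => // H1.
  - rewrite inE => al.
    rewrite /pay payoff_forever ?normr0// => k.
    have [kn|nk] := leqP k n; first exact: alive_nonincr al.
    apply: contrapT => nal; move/negP: H1; apply; rewrite inE.
    by exists (k - n)%N => //; split=> //; rewrite subnKC// ltnW.
  - by exfalso; apply: nAn; move: H1; rewrite !inE => -[k _ []].
rewrite UF.
have cvgF : (\int[P]_(w in F k) `|pay w|%:E)%E @[k --> \oo] -->
    (\int[P]_(w in \bigcup_k F k) `|pay w|%:E)%E.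
  apply: ge0_nondecreasing_set_cvg_integral => //.
  move=> j k jk; apply/subsetPset => w [al nal]; split=> // al'; apply: nal.
  by apply: alive_nonincr al'; rewrite leq_add2l.
rewrite -(cvg_lim _ cvgF)//; apply: lime_le; first by apply/cvg_ex; eexists; exact: cvgF.
near=> k; apply: le_trans (payoff_mass_upto n k).
by rewrite leeDl.
Unshelve. all: by end_near. Qed.

Let hit n : set Omega := [set w | xi n w <= p n (X n w)].

Let mhit n : measurable (hit n).
Proof. by apply: (@history_measurable _ _ _ _ _ X eta xi n n.+1); exact: hit_history. Qed.

Lemma payoff_integrable : P.-integrable setT (EFin \o pay).
Proof.
apply/integrableP; split; first exact/measurable_EFinP.
have A0 : A 0%N = setT.
  by apply/seteqP; split=> // w _; apply/andP; split; [case: (s w)|case: (t w)].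
have := payoff_mass 0; rewrite A0 => /le_lt_trans; apply.
by rewrite /mass expr0 mul1e (majorant_state_integrable alpha0 mM M0 excM markov ind).
Qed.

Lemma Rintegral_split F B C : P.-integrable setT (EFin \o F) -> measurable B ->
  measurable C ->
  \int[P]_(w in B) F w = \int[P]_(w in B `&` C) F w + \int[P]_(w in B `\` C) F w.
Proof.
move=> iF mB mC; have BE : B = (B `&` C) `|` (B `\` C) by rewrite setUIDK.
rewrite {1}BE Rintegral_setU//.
- exact: measurableI.
- exact: measurableD.
- by rewrite -BE; exact: integrableS iF.
- by apply/disj_setPS => w [[_ ?] [_ ?]].
Qed.

Let iX n B u : dominated M u -> measurable B -> P.-integrable B (EFin \o (u \o X n)).
Proof. exact: (dominated_state_integrable alpha0 mM M0 excM markov ind). Qed.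

Let dmul n u : dominated M u -> dominated M (fun y => p n y * u y).
Proof. by move=> du; exact: dominated_mul. Qed.

Let p01C n y : 0 <= 1 - p n y <= 1.
Proof. by have /andP[? ?] := p01 n y; apply/andP; split; lra. Qed.

Let dmulC n u : dominated M u -> dominated M (fun y => (1 - p n y) * u y).
Proof.
by move=> du; apply: dominated_mul => //; apply: measurable_funB => //; exact: mp.
Qed.

Let hit_Rintegral n B u : history X eta xi n n B -> dominated M u ->
  \int[P]_(w in B `&` hit n) u (X n w) = \int[P]_(w in B) (p n (X n w) * u (X n w)).
Proof.
by move=> hB du; apply: (randomization_Rintegral alpha0 mM M0 excM markov iid ind).
Qed.

Let miss_Rintegral n B u : history X eta xi n n B -> dominated M u ->
  \int[P]_(w in B `\` hit n) u (X n w) =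
  \int[P]_(w in B) ((1 - p n (X n w)) * u (X n w)).
Proof.
move=> hB du; have mB := history_measurable hB.
have := Rintegral_split (iX n du measurableT) mB (mhit n).
rewrite hit_Rintegral// => /eqP; rewrite addrC -subr_eq => /eqP <-.
rewrite -RintegralB//; [|exact: iX|exact: (iX n (dmul n du))].
by apply: eq_Rintegral => w _; rewrite mulrBl mul1r.
Qed.

(** The event that the game is running at time [n] is cut according to whether the
    opponent stops now ([S] fails) and whether the player does ([hit n]). Averaging
    over the randomization replaces [hit n] by the weight [p n (X n)], and the two
    inequalities of [secures_col], one for each reply of the opponent, bound the
    two resulting integrals by those of [u]. *)
Lemma verification_step n u : dominated M u ->
  (forall y, secures_col (h y) (f y) (g y) (alpha * kernel_op Pi u y) (p n y) (u y)) ->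
  \int[P]_(w in A n) pay w - alpha ^+ n * \int[P]_(w in A n) u (X n w) <=
  \int[P]_(w in A n.+1) pay w - alpha ^+ n.+1 * \int[P]_(w in A n.+1) u (X n.+1 w).
Proof.
move=> du opt; have a0 : 0 <= alpha ^+ n by rewrite exprn_ge0// ltW.
pose S := [set w | running (s w) n.+1].
have hS : history X eta xi n n S by exact: history_opponent (@running_opponent n).
have hH2 : history X eta xi n n (A n `&` S).
  by apply: generated_setI => //; exact: alive_history.
have hH1 : history X eta xi n n (A n `\` S).
  rewrite setDE; apply: generated_setI; first exact: alive_history.
  exact: (sigma_algebraC hS).
have mS := history_measurable hS.
have mH1 := history_measurable hH1; have mH2 := history_measurable hH2.
(* the game goes on when neither player stops at n *)
have AS : A n.+1 = (A n `&` S) `\` hit n.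
  apply/seteqP; split=> w; rewrite /A /alive/= /t running_randomized_timeS.
    move=> /andP[sw /andP[tw /negP nh]]; split=> //; split=> //.
    by rewrite tw (running_le _ sw).
  by move=> [[/andP[_ ->] ->] /negP ->].
have stageE B (v : E -> R) : dominated M v -> measurable B ->
    (forall w, B w -> pay w = alpha ^+ n * v (X n w)) ->
    \int[P]_(w in B) pay w = alpha ^+ n * \int[P]_(w in B) v (X n w).
  move=> dv mB payE; rewrite -RintegralZl//; last exact: iX.
  by apply: eq_Rintegral => w; rewrite inE => /payE.
have tS w : running (t w) n.+1 = running (t w) n && ~~ (xi n w <= p n (X n w)).
  exact: running_randomized_timeS.
rewrite (Rintegral_split payoff_integrable (mA n) mS).
rewrite (Rintegral_split payoff_integrable mH2 (mhit n)) -AS.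
rewrite (Rintegral_split payoff_integrable mH1 (mhit n)).
rewrite (stageE (A n `&` S `&` hit n) g)//; first last.
- move=> w [[al Sw] hw]; rewrite /pay (@payoff_stage _ _ _ _ _ _ _ _ _ _ _ _ n)//.
    by rewrite /stage_payoff [running _ _]Sw.
  by rewrite /alive/= tS [_ <= _]hw andbF andbF.
- exact: measurableI.
rewrite (stageE ((A n `\` S) `&` hit n) h)//; first last.
- move=> w [[al /negP nSw] hw]; rewrite /pay (@payoff_stage _ _ _ _ _ _ _ _ _ _ _ _ n)//.
    by rewrite /stage_payoff (negbTE nSw) tS [_ <= _]hw andbF.
  by rewrite /alive/= (negbTE nSw).
- exact: measurableI.
rewrite (stageE ((A n `\` S) `\` hit n) f)//; first last.
- move=> w [[al /negP nSw] /negP hw]; rewrite /pay (@payoff_stage _ _ _ _ _ _ _ _ _ _ _ _ n)//.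
    by rewrite /stage_payoff (negbTE nSw) tS hw; case/andP: al => _ ->.
  by rewrite /alive/= (negbTE nSw).
- exact: measurableD.
(* the event alive n.+1 is decided at time n, after the randomization *)
rewrite (markov_Rintegral alpha0 mM M0 excM markov ind (@alive_history_next n) du).
have dc := dominated_continuation alpha0 mM M0 excM du.
have -> : alpha ^+ n.+1 * \int[P]_(w in A n.+1) kernel_op Pi u (X n w) =
    alpha ^+ n * \int[P]_(w in A n.+1) (alpha * kernel_op Pi u (X n w)).
  rewrite exprSr -mulrA RintegralZl//.
  exact: (kernel_op_dominated_integrable alpha0 mM M0 excM markov ind).
rewrite AS (miss_Rintegral hH2 dc) (miss_Rintegral hH1 df).
rewrite (hit_Rintegral hH2 dg) (hit_Rintegral hH1 dh).
rewrite (Rintegral_split (iX n du measurableT) (mA n) mS).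
have le2 : \int[P]_(w in A n `&` S) (p n (X n w) * g (X n w)) +
    \int[P]_(w in A n `&` S) ((1 - p n (X n w)) * (alpha * kernel_op Pi u (X n w))) <=
    \int[P]_(w in A n `&` S) u (X n w).
  rewrite -RintegralD//; [|exact: (iX n (dmul n dg))|exact: (iX n (dmulC n dc))].
  apply: le_Rintegral => //.
  - exact: (integrableD mH2 (iX n (dmul n dg) mH2) (iX n (dmulC n dc) mH2)).
  - exact: iX.
  - by move=> w _; have [_ _] := opt (X n w).
have le1 : \int[P]_(w in A n `\` S) (p n (X n w) * h (X n w)) +
    \int[P]_(w in A n `\` S) ((1 - p n (X n w)) * f (X n w)) <=
    \int[P]_(w in A n `\` S) u (X n w).
  rewrite -RintegralD//; [|exact: (iX n (dmul n dh))|exact: (iX n (dmulC n df))].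
  apply: le_Rintegral => //.
  - exact: (integrableD mH1 (iX n (dmul n dh) mH1) (iX n (dmulC n df) mH1)).
  - exact: iX.
  - by move=> w _; have [_ + _] := opt (X n w).
have := ler_wpM2l a0 le1; have := ler_wpM2l a0 le2.
lra.
Qed.

(** Stagewise optimality from time [n] on bounds the payoff collected from then on,
    since the gap between the two sides increases with [n] and tends to zero. *)
Lemma verification n u : dominated M u ->
  (forall k y, (n <= k)%N ->
     secures_col (h y) (f y) (g y) (alpha * kernel_op Pi u y) (p k y) (u y)) ->
  \int[P]_(w in A n) pay w <= alpha ^+ n * \int[P]_(w in A n) u (X n w).
Proof.
move=> du opt.
(* the gap increases with k and is bounded by twice the discounted mass of M *)
pose e k := \int[P]_(w in A k) pay w - alpha ^+ k * \int[P]_(w in A k) u (X k w).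
have e_le k : e n <= e (n + k)%N.
  elim: k => [|k IH]; first by rewrite addn0.
  rewrite addnS; apply: le_trans IH _; apply: verification_step => // y.
  by apply: opt; exact: leq_addr.
pose m k := alpha ^+ k * \int[P]_w M (X k w).
have dM : dominated M M by exact: dominated_majorant.
have iM k B : measurable B -> P.-integrable B (EFin \o (M \o X k)) by exact: iX.
have a0 k : 0 <= alpha ^+ k by rewrite exprn_ge0// ltW.
have le_m k : \int[P]_(w in A k) M (X k w) <= \int[P]_w M (X k w).
  rewrite (Rintegral_split (iM k _ measurableT) measurableT (mA k)) setTI.
  by rewrite lerDl; apply: Rintegral_ge0 => w _; exact: M0.
have e_m k : e k <= m k *+ 2.
  have h1 : \int[P]_(w in A k) pay w <= m k.
    have ipay : P.-integrable (A k) (EFin \o pay) by exact: integrableS payoff_integrable.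
    apply: le_trans (ler_norm _) _.
    apply: le_trans (le_normr_Rintegral (mA k) ipay) _.
    apply: le_trans (ler_wpM2l (a0 k) (le_m k)).
    have := payoff_mass k; rewrite /mass -(fineK (integrable_fin_num (mA k) (iM k _ (mA k)))).
    move/integrable_abse : ipay => /(integrable_fin_num (mA k))/fineK <-.
    by rewrite -EFinM lee_fin.
  have h2 : - (alpha ^+ k * \int[P]_(w in A k) u (X k w)) <= m k.
    apply: le_trans (ler_norm _) _; rewrite normrN normrM ger0_norm//.
    apply: ler_wpM2l => //.
    apply: le_trans (le_m k).
    apply: le_trans (le_normr_Rintegral (mA k) (iX k du (mA k))) _.
    apply: le_Rintegral => //; last by move=> w _; exact: du.2.
      exact: (integrable_abse (iX k du (mA k))).
    exact: iM.
  by rewrite mulr2n /e lerD.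
have cvm : m @ \oo --> 0.
  have : (fun k => (m k)%:E) @ \oo --> 0%E.
    rewrite (_ : (fun k => _) = (fun k => (alpha ^+ k)%:E * \int[P]_w (M (X k w))%:E)%E)//.
    apply/funext => k; rewrite /m EFinM fineK//.
    exact: (integrable_fin_num measurableT (iM k _ measurableT)).
  by move/fine_cvgP => [].
rewrite -subr_le0 -/(e n).
have cv2 : (fun k => m (n + k)%N *+ 2) @ \oo --> (0 : R).
  rewrite -(mul0rn _ 2).
  have -> : (fun k => m (n + k)%N *+ 2) = (fun k => m (k + n)%N + m (k + n)%N).
    by apply/funext => k; rewrite addnC mulr2n.
  have cvn : (fun k => m (k + n)%N) @ \oo --> (0 : R) by rewrite cvg_shiftn.
  by rewrite mul0rn -[X in _ --> X]addr0; exact: cvgD.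
apply: (ler_cvg_to (f := fun=> e n) (cvg_cst _) cv2).
by near=> k; apply: le_trans (e_le k) (e_m _).
Unshelve. all: by end_near. Qed.

End verification.

(** * Best replies and deviations *)

Section strategies.
Context d (Omega : measurableType d) (R : realType) d' (E : measurableType d').
Variables (X : nat -> {mfun Omega >-> E}) (xi : nat -> {mfun Omega >-> R}).

Lemma hit_joint_filtration (q : E -> R) n k : (k <= n)%N -> measurable_fun setT q ->
  joint_filtration X xi n [set w | xi k w <= q (X k w)].
Proof.
move=> kn mq; apply: generated_le => B mB; apply: sub_sigma_algebra; exists k => //=.
  by right; exists B => //; rewrite setTI.
left; exists (q @^-1` B); last by rewrite setTI.
by rewrite -[X in measurable X]setTI; exact: mq.
Qed.

Lemma randomized_time_strategy (p : nat -> E -> R) :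
  (forall n, measurable_fun setT (p n)) ->
  strategies X xi (randomized_time X xi p).
Proof.
move=> mp n.
rewrite (_ : [set _ | _] = \bigcup_(k in `I_n.+1) [set w | xi k w <= p k (X k w)]).
  apply: (@bigcup_measurable _ (g_sigma_algebraType _)) => k /= kn.
  exact: hit_joint_filtration.
apply/seteqP; split=> w /=.
  move=> [k kn tk]; apply: contrapT => nhit.
  have : running (randomized_time X xi p w) k.+1.
    apply/running_randomized_time => j jk; apply/negP => H; apply: nhit.
    by exists j => //=; exact: leq_trans jk _.
  by rewrite tk/= ltnn.
move=> [k /= kn hit].
have : ~~ running (randomized_time X xi p w) k.+1.
  by apply/negP => /running_randomized_time/(_ k (ltnSn k)); rewrite hit.
case tw: (randomized_time X xi p w) => [j|] //=.
by rewrite -leqNgt => jk; exists j => //; exact: leq_trans jk _.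
Qed.

Lemma cst_strategy (o : option nat) : strategies X xi (cst o).
Proof.
move=> n; have [H|H] := pselect (exists2 k, (k <= n)%N & o = Some k).
  rewrite (_ : [set _ | _] = setT); first exact: setT_generated.
  by apply/seteqP; split.
rewrite (_ : [set _ | _] = set0); first exact: (@measurable0 _ (g_sigma_algebraType _)).
by apply/seteqP; split.
Qed.

End strategies.

Section best_replies.
Context d (Omega : measurableType d) (R : realType) (P : probability Omega R).
Context d' (E : measurableType d') (Pi : R.-pker E ~> E) (alpha : R) (M : E -> R).
Variables (X : nat -> {mfun Omega >-> E}) (eta xi : nat -> {mfun Omega >-> R}).
Variable x : E.
Hypothesis alpha0 : 0 < alpha.
Hypothesis mM : measurable_fun setT M.
Hypothesis M0 : forall y, 0 <= M y.
Hypothesis excM : forall y, (alpha%:E * \int[Pi y]_z (M z)%:E <= (M y)%:E)%E.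
Hypothesis vanM :
  ((alpha ^+ n)%:E * \int[P]_w (M (X n w))%:E)%E @[n --> \oo] --> 0%E.
Hypothesis markov : is_markov_process P Pi X x.
Hypothesis iid : is_iid_uniform P xi.
Hypothesis ind : forall A B C, sigma_process X A -> sigma_process eta B ->
  sigma_process xi C -> P (A `&` B `&` C) = (P A * P B * P C)%E.
Variables f g h u : E -> R.
Hypotheses (df : dominated M f) (dg : dominated M g) (dh : dominated M h).
Hypothesis du : dominated M u.

Lemma expectationE (Y : Omega -> R) : P.-integrable setT (EFin \o Y) ->
  ('E_P[Y] = (\int[P]_w Y w)%:E)%E.
Proof.
by move=> iY; rewrite unlock /Rintegral fineK//; exact: integrable_fin_num.
Qed.

Lemma Rintegral_initial v : dominated M v -> \int[P]_w v (X 0%N w) = v x.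
Proof.
move=> /(dominated_split M0)[v1 [v2 [dv1 dv2 v10 v20 ->]]].
have nonneg (w : E -> R) : dominated M w -> (forall y, 0 <= w y) ->
    \int[P]_z w (X 0%N z) = w x.
  move=> dw w0; rewrite /Rintegral.
  have gw : ge0_measurable (EFin \o w).
    by split; [apply/measurable_EFinP; exact: dw.1|move=> y; rewrite lee_fin].
  by have := integral_initial markov gw => /= ->.
rewrite RintegralB//; first by rewrite !nonneg.
  exact: (dominated_state_integrable alpha0 mM M0 excM markov ind).
exact: (dominated_state_integrable alpha0 mM M0 excM markov ind).
Qed.

(** The chain starts at [x], so the first randomization succeeds with probability
    [q x]. *)
Lemma hit_initial (q : E -> R) : measurable_fun setT q -> (forall y, 0 <= q y <= 1) ->
  P [set w | xi 0%N w <= q (X 0%N w)] = (q x)%:E.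
Proof.
move=> mq q01.
have hT : history X eta xi 0 0 setT by exact: setT_generated.
have g1 : ge0_measurable (cst 1%:E : E -> \bar R) by split.
have := integral_randomization iid ind hT mq q01 g1.
have gq : ge0_measurable (EFin \o q).
  split; first exact/measurable_EFinP.
  by move=> y; rewrite lee_fin; have /andP[] := q01 y.
have mhit : measurable [set w | xi 0%N w <= q (X 0%N w)].
  apply: (@history_measurable _ _ _ _ _ X eta xi 0 1).
  exact: (hit_history (p := fun=> q)).
rewrite setTI /= pr_integral_cst// mul1e => ->.
under eq_integral do rewrite mule1.
exact: (integral_initial markov gq).
Qed.

Section against_randomized.
Variables (s : Omega -> option nat) (p : nat -> E -> R).
Hypothesis stop_s : strategies X eta s.
Hypothesis mp : forall n, measurable_fun setT (p n).
Hypothesis p01 : forall n y, 0 <= p n y <= 1.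
Let t := randomized_time X xi p.

Let ipay : P.-integrable setT (EFin \o payoff X alpha f g h s t).
Proof. exact: (payoff_integrable alpha0 mM M0 excM markov ind). Qed.

Lemma payoff_upper :
  (forall k y, secures_col (h y) (f y) (g y) (alpha * kernel_op Pi u y) (p k y) (u y)) ->
  ('E_P[payoff X alpha f g h s t] <= (u x)%:E)%E.
Proof.
move=> opt; rewrite expectationE// lee_fin.
have := verification alpha0 mM M0 excM vanM markov iid ind df dg dh stop_s mp p01 du
  (n := 0%N) (fun k y _ => opt k y).
rewrite (_ : alive _ _ 0 = setT).
  by rewrite expr0 mul1r Rintegral_initial.
by apply/seteqP; split=> // w _; rewrite /alive/=;
  case: (s w); case: (randomized_time X xi p w).
Qed.

(** If nobody stops at time 0, only the stages from 1 on have to be optimal, and the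
    bound is the continuation payoff. *)
Lemma payoff_upper_delayed :
  (forall k y, (0 < k)%N ->
    secures_col (h y) (f y) (g y) (alpha * kernel_op Pi u y) (p k y) (u y)) ->
  P (alive s t 1) = 1%E ->
  ('E_P[payoff X alpha f g h s t] <= (alpha * kernel_op Pi u x)%:E)%E.
Proof.
move=> opt P1; rewrite expectationE// lee_fin.
have mA : measurable (alive s t 1).
  exact: history_measurable (alive_history stop_s mp (n := 1%N)).
have null F : P.-integrable setT (EFin \o F) ->
    \int[P]_(w in alive s t 1) F w = \int[P]_w F w.
  move=> iF; rewrite (Rintegral_split iF measurableT mA) setTI.
  rewrite [X in _ = _ + X](_ : _ = 0) ?addr0//.
  rewrite /Rintegral null_set_integral//.
  - by rewrite setTD; exact: measurableC.
  - by apply: measurable_funTS; have /integrableP[] := iF.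
  - transitivity (P (~` alive s t 1)); first by rewrite setTD.
    by rewrite probability_setC// P1 subee.
have := verification alpha0 mM M0 excM vanM markov iid ind df dg dh stop_s mp p01 du
  (n := 1%N) opt.
rewrite !null//; last exact: (dominated_state_integrable alpha0 mM M0 excM markov ind).
have hT : history X eta xi 0 0 setT by exact: setT_generated.
have := markov_Rintegral alpha0 mM M0 excM markov ind hT du.
move=> ->; rewrite -RintegralZl//; last first.
  exact: (kernel_op_dominated_integrable alpha0 mM M0 excM markov ind).
have dc := dominated_continuation alpha0 mM M0 excM du.
by rewrite expr1 (Rintegral_initial dc).
Qed.

End against_randomized.
Lemma expectation_initial (Y : Omega -> R) v B : measurable_fun setT Y -> measurable B ->
  P B = 1%E -> dominated M v -> (forall w, B w -> Y w = v (X 0%N w)) ->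
  ('E_P[Y] = (v x)%:E)%E.
Proof.
move=> mY mB P1 dv YE.
have mX : measurable_fun setT (X 0%N) by [].
have iv : P.-integrable setT (EFin \o (v \o X 0%N)).
  exact: (dominated_state_integrable alpha0 mM M0 excM markov ind).
rewrite unlock -(Rintegral_initial dv) /Rintegral fineK; last exact: integrable_fin_num.
apply: ae_eq_integral => //.
- exact/measurable_EFinP.
- by have /integrableP[] := iv.
exists (~` B); split; first exact: measurableC.
  by transitivity (P (~` B)); [|rewrite probability_setC// P1 subee].
by move=> w /= H Bw; apply: H => _; rewrite YE.
Qed.

End best_replies.

Section deviations.
Context d (Omega : measurableType d) (R : realType) (P : probability Omega R).
Context d' (E : measurableType d') (Pi : R.-pker E ~> E) (alpha : R) (M : E -> R).
Variables (X : nat -> {mfun Omega >-> E}) (eta xi : nat -> {mfun Omega >-> R}).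
Variable x : E.
Hypothesis alpha0 : 0 < alpha.
Hypothesis mM : measurable_fun setT M.
Hypothesis M0 : forall y, 0 <= M y.
Hypothesis excM : forall y, (alpha%:E * \int[Pi y]_z (M z)%:E <= (M y)%:E)%E.
Hypothesis vanM :
  ((alpha ^+ n)%:E * \int[P]_w (M (X n w))%:E)%E @[n --> \oo] --> 0%E.
Hypothesis markov : is_markov_process P Pi X x.
Hypothesis iid : is_iid_uniform P xi.
Hypothesis ind : forall A B C, sigma_process X A -> sigma_process eta B ->
  sigma_process xi C -> P (A `&` B `&` C) = (P A * P B * P C)%E.
Variables f g h u : E -> R.
Hypotheses (df : dominated M f) (dg : dominated M g) (dh : dominated M h).
Hypothesis du : dominated M u.

Hypothesis iid_eta : is_iid_uniform P eta.
Variables q1 q : E -> R.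
Hypotheses (mq1 : measurable_fun setT q1) (q101 : forall y, 0 <= q1 y <= 1).
Hypotheses (mq : measurable_fun setT q) (q01 : forall y, 0 <= q y <= 1).
Hypothesis opt : forall y,
  secures_col (h y) (f y) (g y) (alpha * kernel_op Pi u y) (q y) (u y).
Let s := markov_time X eta q1.
Hypothesis secured : forall t, strategies X xi t ->
  ((u x)%:E <= 'E_P[payoff X alpha f g h s t])%E.

Let ind_swap A B C : sigma_process X A -> sigma_process xi B ->
  sigma_process eta C -> P (A `&` B `&` C) = (P A * P B * P C)%E.
Proof. by move=> sA sB sC; rewrite setIAC ind// muleAC. Qed.

Let hit : set Omega := [set w | eta 0%N w <= q1 (X 0%N w)].

Let mhit : measurable hit.
Proof.
apply: (@history_measurable _ _ _ _ _ X xi eta 0 1).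
exact: (hit_history (p := fun=> q1)).
Qed.

Let s1 w : running (s w) 1 = ~~ (eta 0%N w <= q1 (X 0%N w)).
Proof.
rewrite (running_randomized_timeS X eta (fun=> q1)).
by case: (randomized_time X eta (fun=> q1) w).
Qed.

Let s_hit w : hit w -> s w = Some 0%N.
Proof.
move=> hw; have := s1 w; rewrite [_ <= _]hw/=.
by case: (s w) => //= -[].
Qed.

Let measurable_deviation o : measurable_fun setT (payoff X alpha f g h s (cst o)).
Proof.
apply: measurable_payoff; [exact: df.1|exact: dg.1|exact: dh.1| |] => n.
  exact: (measurable_running_own (p := fun=> q1) X xi eta (fun=> mq1) n).
have [H|H] := boolP (running o n).
  by rewrite (_ : [set _ | _] = setT)//; apply/seteqP; split.
by rewrite (_ : [set _ | _] = set0)//; apply/seteqP; split=> // w /=; rewrite (negbTE H).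
Qed.

(** Test a guarantee given by stopping at [x] against the replies of stopping at
    once and of never stopping: the payoffs are [h x] and [f x]. *)
Lemma secured_stop : q1 x = 1 -> u x <= h x /\ u x <= f x.
Proof.
move=> q1x.
have P1 : P hit = 1%E.
  by rewrite (hit_initial markov iid_eta ind_swap mq1 q101) q1x.
split; rewrite -lee_fin.
  apply: le_trans (@secured _ (@cst_strategy _ _ _ _ _ X xi (Some 0%N))) _.
  rewrite (expectation_initial alpha0 mM M0 excM markov ind
    (measurable_deviation _) mhit P1 dh)// => w /s_hit sw.
  by rewrite /payoff sw/= mul1r.
apply: le_trans (@secured _ (@cst_strategy _ _ _ _ _ X xi None)) _.
rewrite (expectation_initial alpha0 mM M0 excM markov ind
  (measurable_deviation _) mhit P1 df)// => w /s_hit sw.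
by rewrite /payoff sw/= mul1r.
Qed.

(** Test a guarantee given by continuing at [x] against the replies of stopping at
    once, which pays [g x], and of continuing once and playing stagewise optimally
    afterwards, which leaves at most the continuation payoff. *)
Lemma secured_continue : q1 x = 0 -> u x <= g x /\ u x <= alpha * kernel_op Pi u x.
Proof.
move=> q1x.
have P1 : P (~` hit) = 1%E.
  by rewrite probability_setC// (hit_initial markov iid_eta ind_swap mq1 q101) q1x sube0.
have mC := measurableC mhit.
split; rewrite -lee_fin.
  apply: le_trans (@secured _ (@cst_strategy _ _ _ _ _ X xi (Some 0%N))) _.
  rewrite (expectation_initial alpha0 mM M0 excM markov ind
    (measurable_deviation _) mC P1 dg)// => w /negP nh.
  rewrite /payoff; have := s1 w; rewrite nh.
  by case: (s w) => [[|k]|] //= _; rewrite mul1r.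
(* the hit at time 0 is the null event xi 0 <= 0 *)
pose p (n : nat) : E -> R := if n is 0 then cst 0 else q.
have mp n : measurable_fun setT (p n) by case: n => [|n] //; exact: measurable_cst.
have p01 n y : 0 <= p n y <= 1 by case: n => [|n]; [rewrite /p lexx ler01|exact: q01].
apply: le_trans (@secured _ (@randomized_time_strategy _ _ _ _ _ X xi p mp)) _.
apply: (payoff_upper_delayed alpha0 mM M0 excM vanM markov iid ind df dg dh du).
- exact: (@randomized_time_strategy _ _ _ _ _ X eta (fun=> q1)).
- exact: mp.
- exact: p01.
- by case=> // k y _; exact: opt.
pose hit' : set Omega := [set w | xi 0%N w <= p 0%N (X 0%N w)].
have mhit' : measurable hit'.
  apply: (@history_measurable _ _ _ _ _ X eta xi 0 1).
  exact: (hit_history (p := p)).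
have P0 : P hit' = 0%E by rewrite (hit_initial markov iid ind (mp 0%N) (p01 0%N)).
have aliveE : alive s (randomized_time X xi p) 1 = ~` (hit `|` hit').
  apply/seteqP; split=> w; rewrite /alive/= s1 (running_randomized_timeS X xi p).
    by move=> /and3P[/negP nh _ /negP nh'] [].
  move=> H; apply/and3P; split; last by apply/negP => hw; apply: H; right.
    by apply/negP => hw; apply: H; left.
  by case: (randomized_time X xi p w).
rewrite aliveE probability_setC; last exact: measurableU.
rewrite (_ : P (hit `|` hit') = 0%E) ?sube0//.
apply/eqP; rewrite eq_le measure_ge0 andbT.
apply: le_trans (measureU2 _ mhit mhit') _.
rewrite [X in (_ + X)%E]P0 adde0.
by rewrite [leLHS](_ : _ = P hit)// (hit_initial markov iid_eta ind_swap mq1 q101) q1x.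
Qed.

End deviations.

(** * Value and equilibria *)

(** Exchanging the players: the game with payoffs [(- g, - f, - h)] seen from the
    other side. Every bound for one player transfers to the other. *)
Lemma payoff_mirror d (Omega : measurableType d) (R : realType) d' (E : measurableType d')
    (X : nat -> {mfun Omega >-> E}) (alpha : R) (f g h : E -> R)
    (s t : Omega -> option nat) w :
  payoff X alpha f g h s t w = - payoff X alpha (\- g) (\- f) (\- h) t s w.
Proof.
rewrite /payoff; case: (s w) => [m|]; case: (t w) => [n|]; rewrite ?oppr0//=; last 2 first.
- by rewrite mulrN opprK.
- by rewrite mulrN opprK.
case: (ltngtP m n) => [mn|nm|->]; by rewrite mulrN opprK.
Qed.

Section game.
Context (R : realType) d d' (Omega : measurableType d) (E : measurableType d').
Variables (Pi : R.-pker E ~> E) (P : E -> probability Omega R).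
Variables (X : nat -> {mfun Omega >-> E}) (xi1 xi2 : nat -> {mfun Omega >-> R}).
Variables (T : {mfun Omega >-> nat}) (alpha : R) (f g h : {mfun E >-> R}).
Hypothesis alpha0 : 0 < alpha.
Hypothesis markovX : forall x, is_markov_process (P x) Pi X x.
Hypothesis unif1 : forall x, is_iid_uniform (P x) xi1.
Hypothesis unif2 : forall x, is_iid_uniform (P x) xi2.
Hypothesis indep : forall x, independent_sources (P x) X xi1 xi2 T.
Variables M u : E -> R.
Hypothesis HM : majorant Pi P X alpha f g h M.
Hypothesis du : dominated M u.
Hypothesis fixu : forall y, u y = shapley Pi alpha f g h u y.

Let c y := alpha * kernel_op Pi u y.
Let J := J1 P X alpha f g h.

Let M0 y : 0 <= M y.
Proof. exact: le_trans (normr_ge0 (f y)) (majorant_f HM y). Qed.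

Let mM := majorant_measurable HM.
Let excM := majorant_excessive HM.

Let df : dominated M f. Proof. by split=> //; exact: majorant_f HM. Qed.
Let dg : dominated M g. Proof. by split=> //; exact: majorant_g HM. Qed.
Let dh : dominated M h. Proof. by split=> //; exact: majorant_h HM. Qed.

Lemma dominatedN v : dominated M v -> dominated M (\- v).
Proof.
move=> [mv vM]; split; first exact: measurable_funN.
by move=> y /=; rewrite normrN.
Qed.

Lemma kernel_opN v y : dominated M v -> kernel_op Pi (\- v) y = - kernel_op Pi v y.
Proof.
move=> dv; rewrite /kernel_op -mulN1r -RintegralZl//.
  by apply: eq_Rintegral => z _; rewrite mulN1r.
exact: (dominated_integrable alpha0 mM M0 excM).
Qed.

Let mc : measurable_fun setT c.
Proof. exact: (dominated_continuation alpha0 mM M0 excM du).1. Qed.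

Definition optimal1 (p : E -> R) := markov_strategy p /\
  forall y, secures_row (h y) (f y) (g y) (c y) (p y) (u y).
Definition optimal2 (p : E -> R) := markov_strategy p /\
  forall y, secures_col (h y) (f y) (g y) (c y) (p y) (u y).

Lemma optimal1_exists : exists p, optimal1 p.
Proof.
exists (fun y => row_strategy (h y) (f y) (g y) (c y)); split; last first.
  by move=> y; rewrite fixu; exact: row_strategy_secures.
split; first exact: measurable_row_strategy.
by move=> y; have [] := row_strategy_secures (h y) (f y) (g y) (c y).
Qed.

Lemma optimal2_exists : exists p, optimal2 p.
Proof.
exists (fun y => col_strategy (h y) (f y) (g y) (c y)); split; last first.
  by move=> y; rewrite fixu; exact: col_strategy_secures.
split; first exact: measurable_col_strategy.
by move=> y; have [] := col_strategy_secures (h y) (f y) (g y) (c y).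
Qed.

Lemma optimal2_upper p x s : optimal2 p -> strategies X xi1 s ->
  (J x s (markov_time X xi2 p) <= (u x)%:E)%E.
Proof.
move=> [[mp p01] sec] Ss.
exact: (payoff_upper alpha0 mM M0 excM (majorant_vanishes HM x) (markovX x) (unif2 x)
  (independent_sources3 (indep x)) df dg dh du Ss (fun=> mp) (fun=> p01) (fun=> sec)).
Qed.

Lemma expectation_mirror x s t :
  (P x).-integrable setT (EFin \o payoff X alpha f g h s t) ->
  J x s t = (- 'E_(P x)[payoff X alpha (\- g)%R (\- f)%R (\- h)%R t s])%E.
Proof.
move=> ip; rewrite /J /J1.
have -> : payoff X alpha (\- g) (\- f) (\- h) t s =
    (fun w => -1 * payoff X alpha f g h s t w).
  by apply/funext => w; rewrite (payoff_mirror X alpha f) mulN1r opprK.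
rewrite !expectationE//; first by rewrite RintegralZl// mulN1r EFinN oppeK.
by have := integrableZl measurableT (-1) ip; congr (integrable _ _ _).
Qed.

Let integrable1 x p t : markov_strategy p -> strategies X xi2 t ->
  (P x).-integrable setT (EFin \o payoff X alpha f g h (markov_time X xi1 p) t).
Proof.
move=> [mp p01] St.
have := payoff_integrable alpha0 mM M0 excM (markovX x)
    (independent_sources3_swap (indep x)) (dominatedN dg) (dominatedN df)
    (dominatedN dh) St (fun=> mp).
move=> /(integrableZl measurableT (-1)); congr (integrable _ _ _).
by apply/funext => w; rewrite /= -EFinM (payoff_mirror X alpha f) mulN1r.
Qed.

Let mirror_secures q y : secures_row (h y) (f y) (g y) (c y) q (u y) ->
  secures_col ((\- h) y) ((\- g) y) ((\- f) y) (alpha * kernel_op Pi (\- u) y) q ((\- u) y).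
Proof. by rewrite kernel_opN// mulrN => /secures_rowN. Qed.

Lemma optimal1_lower p x t : optimal1 p -> strategies X xi2 t ->
  ((u x)%:E <= J x (markov_time X xi1 p) t)%E.
Proof.
move=> [[mp p01] sec] St; rewrite expectation_mirror; last exact: integrable1.
rewrite leeNr -EFinN.
exact: (payoff_upper alpha0 mM M0 excM (majorant_vanishes HM x) (markovX x) (unif1 x)
  (independent_sources3_swap (indep x)) (dominatedN dg) (dominatedN df) (dominatedN dh)
  (dominatedN du) St (fun=> mp) (fun=> p01) (fun _ y => mirror_secures (sec y))).
Qed.

Lemma markov_time_strategy1 p : markov_strategy p ->
  strategies X xi1 (markov_time X xi1 p).
Proof.
by move=> [mp _]; exact: (@randomized_time_strategy _ _ _ _ _ X xi1 (fun=> p) (fun=> mp)).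
Qed.

Lemma markov_time_strategy2 p : markov_strategy p ->
  strategies X xi2 (markov_time X xi2 p).
Proof.
by move=> [mp _]; exact: (@randomized_time_strategy _ _ _ _ _ X xi2 (fun=> p) (fun=> mp)).
Qed.

(** Stagewise optimal strategies secure [u] for both players. *)
Lemma value_shapley x : value P X xi1 xi2 alpha f g h x = u x.
Proof.
have [p1 o1] := optimal1_exists; have [p2 o2] := optimal2_exists.
rewrite /value (_ : ereal_sup _ = (u x)%:E)//.
apply/eqP; rewrite eq_le; apply/andP; split.
  apply: ge_ereal_sup => _ [s Ss <-].
  apply: le_trans (optimal2_upper x o2 Ss).
  apply: ereal_inf_lbound; exists (markov_time X xi2 p2) => //.
  exact: markov_time_strategy2 o2.1.
apply: le_trans (ereal_sup_ubound _); last first.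
  by exists (markov_time X xi1 p1) => //; exact: markov_time_strategy1 o1.1.
by apply: le_ereal_inf_tmp => _ [t St <-]; exact: optimal1_lower.
Qed.

Lemma optimal_equilibrium p1 p2 : optimal1 p1 -> optimal2 p2 ->
  markov_equilibrium P X xi1 xi2 alpha f g h p1 p2.
Proof.
move=> o1 o2; split; [exact: o1.1|exact: o2.1|move=> x tau1 tau2].
have S1 := markov_time_strategy1 o1.1; have S2 := markov_time_strategy2 o2.1.
have Ju : J x tau1 tau2 = (u x)%:E.
  apply/eqP; rewrite eq_le optimal1_lower// andbT; exact: optimal2_upper.
rewrite -/(J x tau1 tau2); split; apply/eqP; rewrite eq_le; apply/andP; split.
- apply: ge_ereal_sup => _ [s Ss <-]; rewrite Ju; exact: optimal2_upper.
- by apply: ereal_sup_ubound; exists tau1.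
- apply: le_ereal_inf_tmp => _ [t St <-]; rewrite Ju; exact: optimal1_lower.
- by apply: ereal_inf_lbound; exists tau2.
Qed.

Section equilibrium.
Variables p1 p2 : E -> R.
Hypothesis eqm : markov_equilibrium P X xi1 xi2 alpha f g h p1 p2.

Let m1 : markov_strategy p1. Proof. by case: eqm. Qed.
Let m2 : markov_strategy p2. Proof. by case: eqm. Qed.

(** The payoff of an equilibrium is [u x], because each player could use a stagewise
    optimal strategy instead; so each player's time secures [u x]. *)
Lemma equilibrium_bounds x s t : strategies X xi1 s -> strategies X xi2 t ->
  (J x s (markov_time X xi2 p2) <= (u x)%:E <= J x (markov_time X xi1 p1) t)%E.
Proof.
move=> Ss St; have [q1 o1] := optimal1_exists; have [q2 o2] := optimal2_exists.
have [_ _ /(_ x) [/= sup inf]] := eqm.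
have up s' : strategies X xi1 s' ->
    (J x s' (markov_time X xi2 p2) <= J x (markov_time X xi1 p1) (markov_time X xi2 p2))%E.
  by move=> S'; rewrite /J -sup; apply: ereal_sup_ubound; exists s'.
have lo t' : strategies X xi2 t' ->
    (J x (markov_time X xi1 p1) (markov_time X xi2 p2) <= J x (markov_time X xi1 p1) t')%E.
  by move=> S'; rewrite /J inf; apply: ereal_inf_lbound; exists t'.
have S1 := markov_time_strategy1 o1.1; have S2 := markov_time_strategy2 o2.1.
have Ju : J x (markov_time X xi1 p1) (markov_time X xi2 p2) = (u x)%:E.
  apply/eqP; rewrite eq_le; apply/andP; split.
    by apply: le_trans (lo _ S2) _; apply: optimal2_upper => //; exact: markov_time_strategy1.
  by apply: le_trans (up _ S1); apply: optimal1_lower => //; exact: markov_time_strategy2.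
by rewrite -Ju up// lo.
Qed.

Lemma equilibrium_row x :
  (p1 x = 1 -> u x <= h x /\ u x <= f x) /\ (p1 x = 0 -> u x <= g x /\ u x <= c x).
Proof.
have [q2 [[mq q01] sec]] := optimal2_exists.
have secured t : strategies X xi2 t ->
    ((u x)%:E <= 'E_(P x)[payoff X alpha f g h (markov_time X xi1 p1) t])%E.
  by move=> St; have /andP[] := equilibrium_bounds x (markov_time_strategy1 m1) St.
split.
  exact: (secured_stop alpha0 mM M0 excM (markovX x)
    (independent_sources3 (indep x)) df dg dh (unif1 x) m1.1 m1.2 secured).
exact: (secured_continue alpha0 mM M0 excM (majorant_vanishes HM x) (markovX x) (unif2 x)
  (independent_sources3 (indep x)) df dg dh du (unif1 x) m1.1 m1.2 mq q01 sec secured).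
Qed.

Lemma equilibrium_col x :
  (p2 x = 1 -> h x <= u x /\ g x <= u x) /\ (p2 x = 0 -> f x <= u x /\ c x <= u x).
Proof.
have [q1 [[mq q01] sec]] := optimal1_exists.
have secured s : strategies X xi1 s ->
    (((\- u)%R x)%:E <=
     'E_(P x)[payoff X alpha (\- g)%R (\- f)%R (\- h)%R (markov_time X xi2 p2) s])%E.
  move=> Ss; have /andP[+ _] := equilibrium_bounds x Ss (markov_time_strategy2 m2).
  rewrite expectation_mirror; last first.
  exact: (payoff_integrable alpha0 mM M0 excM (markovX x)
    (independent_sources3 (indep x)) df dg dh Ss (fun=> m2.1)).
  by rewrite leeNl EFinN.
split=> px.
  have [] := secured_stop alpha0 mM M0 excM (markovX x)
    (independent_sources3_swap (indep x)) (dominatedN dg) (dominatedN df) (dominatedN dh)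
    (unif2 x) m2.1 m2.2 secured px.
  by rewrite !lerN2.
have [] := secured_continue alpha0 mM M0 excM (majorant_vanishes HM x) (markovX x) (unif1 x)
  (independent_sources3_swap (indep x)) (dominatedN dg) (dominatedN df) (dominatedN dh)
  (dominatedN du) (unif2 x) m2.1 m2.2 mq q01 (fun y => mirror_secures (sec y)) secured px.
by rewrite kernel_opN// mulrN !lerN2.
Qed.

End equilibrium.
End game.

(** * Characterization of pure equilibria *)

Theorem theorem5p8 (R : realType) (dO dE : measure_display)
    (Omega : measurableType dO) (E : measurableType dE)
    (Pi : R.-pker E ~> E) (P : E -> probability Omega R)
    (X : nat -> {mfun Omega >-> E}) (xi1 xi2 : nat -> {mfun Omega >-> R})
    (T : {mfun Omega >-> nat}) (alpha : R) (f g h : {mfun E >-> R})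
    (alpha01 : 0 < alpha < 1)
    (markovX : forall x, is_markov_process (P x) Pi X x)
    (unif1 : forall x, is_iid_uniform (P x) xi1)
    (unif2 : forall x, is_iid_uniform (P x) xi2)
    (killT : forall x, is_killing_time (P x) alpha T)
    (indep : forall x, independent_sources (P x) X xi1 xi2 T)
    (intf : forall x, sup_killed_in_L1 (P x) X T f)
    (intg : forall x, sup_killed_in_L1 (P x) X T g)
    (inth : forall x, sup_killed_in_L1 (P x) X T h) :
  let V := value P X xi1 xi2 alpha f g h in
  (exists p1 p2 : E -> R,
     [/\ markov_equilibrium P X xi1 xi2 alpha f g h p1 p2, pure p1 & pure p2])
  <->
  (forall x : E,
     Num.max (h x) (alpha * kernel_op Pi V x) >= Num.min (f x) (g x) /\
     Num.min (h x) (alpha * kernel_op Pi V x) <= Num.max (f x) (g x)).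
Proof.
have /andP[alpha0 _] := alpha01.
have [M HM] := majorant_exists (ltW alpha0) markovX killT indep intf intg inth.
have mM := majorant_measurable HM; have excM := majorant_excessive HM.
have M0 y : 0 <= M y := le_trans (normr_ge0 (f y)) (majorant_f HM y).
have df : dominated M f by split=> //; exact: majorant_f HM.
have dg : dominated M g by split=> //; exact: majorant_g HM.
have dh : dominated M h by split=> //; exact: majorant_h HM.
have [u du fixu] := shapley_fixpoint alpha0 mM M0 excM df dg dh.
move=> V; have {V}-> : V = u.
  apply/funext => x.
  exact: (value_shapley alpha0 markovX unif1 unif2 indep HM du fixu x).
split=> [[p1 [p2 [eqm pure1 pure2]]] x|cond].
  have [row1 row0] := equilibrium_row alpha0 markovX unif1 unif2 indep HM du fixu eqm x.
  have [col1 col0] := equilibrium_col alpha0 markovX unif1 unif2 indep HM du fixu eqm x.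
  apply: (@pure_saddle _ _ _ _ _ (u x)).
    by case: (pure1 x) => [/row0|/row1]; [right|left].
  by case: (pure2 x) => [/col0|/col1]; [right|left].
have saddle y : upper_value (h y) (f y) (g y) (alpha * kernel_op Pi u y) <=
    lower_value (h y) (f y) (g y) (alpha * kernel_op Pi u y).
  by have [c1 c2] := cond y; exact: saddle_condition.
have mindic (b : E -> bool) : measurable_fun setT b ->
    markov_strategy (fun y => if b y then 1 else 0 : R).
  move=> mb; split; last by move=> y; case: ifP; rewrite ?lexx ?ler01.
  by apply: measurable_fun_ifT => //; exact: measurable_cst.
(* stop exactly where stopping secures u: by the saddle point,
   continuing secures u everywhere else *)
pose b1 y := u y <= Num.min (h y) (f y).
pose b2 y := Num.max (h y) (g y) <= u y.
exists (fun y => if b1 y then 1 else 0), (fun y => if b2 y then 1 else 0).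
split; [|by move=> y; case: ifP; [right|left]|by move=> y; case: ifP; [right|left]].
apply: (optimal_equilibrium alpha0 markovX unif1 unif2 indep HM du).
- split.
    by apply: mindic; apply: measurable_fun_ler; [exact: du.1|exact: measurable_minr].
  move=> y; rewrite /b1 le_min; case: ifPn => [/andP[uh uf]|nb].
    by split; rewrite ?lexx ?ler01// subrr mul1r mul0r addr0.
  have sec : secures_row (h y) (f y) (g y) (alpha * kernel_op Pi u y)
      (row_strategy (h y) (f y) (g y) (alpha * kernel_op Pi u y)) (u y).
    by rewrite fixu; exact: row_strategy_secures.
  have [[uh uf]|[ug uc]] := saddle_row sec (saddle y); first by rewrite uh uf in nb.
  by split; rewrite ?lexx ?ler01// subr0 mul1r mul0r add0r.
- split.
    by apply: mindic; apply: measurable_fun_ler; [exact: measurable_maxr|exact: du.1].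
  move=> y; rewrite /b2 ge_max; case: ifPn => [/andP[hu gu]|nb].
    by split; rewrite ?lexx ?ler01// subrr mul1r mul0r addr0.
  have sec : secures_col (h y) (f y) (g y) (alpha * kernel_op Pi u y)
      (col_strategy (h y) (f y) (g y) (alpha * kernel_op Pi u y)) (u y).
    by rewrite fixu; exact: col_strategy_secures.
  have [[hu gu]|[fu cu]] := saddle_col sec (saddle y); first by rewrite hu gu in nb.
  by split; rewrite ?lexx ?ler01// subr0 mul1r mul0r add0r.
Qed.
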